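(* Let $M>0$. For any function $\rho\in\mathrm L^1_+(\mathbb R^2)$ such that $\int_{\mathbb R^2}\rho\,dx=M$, we have $$2\int_{\mathbb R^2}\log\left(1+|x|^2\right)\rho\,dx-M\ge\frac2M\iint_{\mathbb R^2\times\mathbb R^2}\rho(x)\,\rho(y)\,\log|x-y|\,dx\,dy\,.$$ Moreover, equality is achieved if and only if $\rho=\rho_\star$, where $$\rho_\star(x):=\frac M{\pi\left(1+|x|^2\right)^2}\quad\text{for all }x\in\mathbb R^2\,.$$
   Context: $\mathrm L^1_+(\mathbb R^2)$ is the set of nonnegative integrable functions on $\mathbb R^2$; $\log$ is the natural logarithm; functions are identified when equal almost everywhere. The statement is understood for those $\rho$ for which the integrals appearing are absolutely convergent. *)

(* Defs.v *)
From HB Require Import structures.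
From mathcomp Require Import all_boot all_order all_algebra.
From mathcomp Require Import all_classical all_reals all_analysis.

Set Implicit Arguments.
Unset Strict Implicit.
Unset Printing Implicit Defensive.

Import Order.TTheory GRing.Theory Num.Theory.
Import numFieldNormedType.Exports.

Local Open Scope classical_set_scope.
Local Open Scope ring_scope.

Definition plane (R : realType) := (measurableTypeR R * measurableTypeR R)%type.

(* The measurable sets of the plane are its Borel sets; every class of
   Lebesgue-measurable functions modulo a.e. equality has a Borel
   representative. *)
Definition lebesgue2 (R : realType) : set (plane R) -> \bar R :=
  (@lebesgue_measure R \x @lebesgue_measure R)%E.

HB.instance Definition _ (R : realType) := Measure.on (@lebesgue2 R).

(* The library's canonical sigma-finiteness instance for [m1 \x m2] is shadowed
   by the one for subprobabilities and is not found by unification. *)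
Fact lebesgue2_sigma_finite (R : realType) : sigma_finite setT (@lebesgue2 R).
Proof.
have /sigma_finiteP[F [TF ndF Foo]] := sigma_finiteT (@lebesgue_measure R).
exists (fun n => F n `*` F n).
  rewrite -setXTT TF predeqE => -[x y]; split.
    move=> [/= [n _ Fnx] [k _ Fky]]; exists (maxn n k) => //; split.
    - by move: x Fnx; exact/subsetPset/ndF/leq_maxl.
    - by move: y Fky; exact/subsetPset/ndF/leq_maxr.
  by move=> [n _ []/= ? ?]; split; exists n.
move=> k; have [? ?] := Foo k.
split; first exact: measurableX.
by rewrite /lebesgue2 product_measure1E// lte_mul_pinfty// ge0_fin_numE.
Qed.

HB.instance Definition _ (R : realType) :=
  Measure_isSigmaFinite.Build _ _ _ (@lebesgue2 R) (@lebesgue2_sigma_finite R).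

(* The library norm on a product is the sup norm, so it cannot be used here. *)
Definition enorm (R : realType) (x : plane R) : R :=
  Num.sqrt (x.1 ^+ 2 + x.2 ^+ 2).

Definition L1plus (R : realType) (rho : plane R -> R) : Prop :=
  (@lebesgue2 R).-integrable setT (EFin \o rho) /\
  {ae @lebesgue2 R, forall x, 0 <= rho x}.

Definition mass (R : realType) (rho : plane R -> R) : R :=
  (\int[@lebesgue2 R]_x rho x)%R.

Definition log_moment_density (R : realType) (rho : plane R -> R)
    (x : plane R) : R :=
  ln (1 + enorm x ^+ 2) * rho x.

(* [ln 0 = 0] in the library; this only affects the diagonal, a null set. *)
Definition log_energy_density (R : realType) (rho : plane R -> R)
    (z : plane R * plane R) : R :=
  rho z.1 * rho z.2 * ln (enorm (z.1.1 - z.2.1, z.1.2 - z.2.2)).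

Definition log_moment (R : realType) (rho : plane R -> R) : R :=
  (\int[@lebesgue2 R]_x log_moment_density rho x)%R.

Definition log_energy (R : realType) (rho : plane R -> R) : R :=
  (\int[(@lebesgue2 R \x @lebesgue2 R)%E]_z log_energy_density rho z)%R.

Definition admissible (R : realType) (M : R) (rho : plane R -> R) : Prop :=
  [/\ L1plus rho,
      mass rho = M,
      (@lebesgue2 R).-integrable setT (EFin \o log_moment_density rho) &
      (@lebesgue2 R \x @lebesgue2 R)%E.-integrable setT
        (EFin \o log_energy_density rho)].

Definition rho_star (R : realType) (M : R) (x : plane R) : R :=
  M / (pi * (1 + enorm x ^+ 2) ^+ 2).

(* Main.v *)
(* Write p for rho_star of mass 1, d2 = |x - y|^2, and J(f, g) for the integral
   of f(x) g(y) ln d2, which is twice the logarithmic energy when f = g.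

   Potential of p. As p is the mixture over s > 0, with density e^-s, of the
   Gaussians (s / pi) e^{-s |y|^2}, the function G(t, x), the integral in y of
   p(y) e^{-t d2}, is explicit. Frullani's formula
   ln b - ln a = int_0^oo (e^{-a t} - e^{-b t}) dt / t turns the integrals of
   p ln(1 + d2) and p (ln(1 + d2) - ln d2) into integrals of G over t, and
   their difference is ln(1 + |x|^2). Hence J(rho, p) is the log moment of rho,
   J(p, p) = 1, and with the neutral deviation sigma = rho - M p,
   2/M log_energy(rho) = 2 log_moment(rho) - M + J(sigma, sigma) / M.

   Sign. Frullani's formula for ln d2 has a kernel of constant sign in t, so
   Fubini applies under the mere integrability of sigma(x) sigma(y) ln d2; as
   sigma has integral zero and Gaussians are squares for convolution,
   J(sigma, sigma) = - (4/pi) int_0^oo int S(2t, w)^2 dw dt, where S(t, w) is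
   the integral of sigma(y) e^{-t |y - w|^2}. If it vanishes then S(t, .) = 0
   a.e. for arbitrarily large t, and letting t -> oo the integral of sigma over
   every quadrant is 0, so sigma = 0 a.e. *)
From HB Require Import structures.
Require Import Defs.
From mathcomp Require Import all_boot all_order all_algebra.
From mathcomp Require Import all_classical all_reals all_analysis.
From mathcomp Require Import measurable_realfun ring lra.
Import Order.TTheory GRing.Theory Num.Theory.
Import numFieldNormedType.Exports.
Local Open Scope classical_set_scope.
Local Open Scope ring_scope.

Set Implicit Arguments.
Unset Strict Implicit.
Unset Printing Implicit Defensive.

(** * Integration over the half-line *)

(** Integrals are exchanged under two regimes. Around the fixed profile, [ln d2] is the difference
    of the nonnegative functions [ln (1 + d2)] and [ln (1 + d2) - ln d2]; identities are proved as
    equalities between sums of nonnegative integrals in the extended reals, and a term is subtracted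
    only once it is known to be finite. For the deviation, which has no sign, absolute convergence
    is needed. The kernel [e^{-t d2} / t] alone diverges at [t = 0]; the reference term [e^{-t} / t]
    makes it converge, and neutrality removes that term again after the exchange. Working with
    Gaussians at each fixed [t] replaces the Fourier transform of the logarithm, which is a singular
    distribution. The half-line is encoded as a restricted measure on the whole line, so that it can
    be a sigma-finite factor of a product and the Fubini theorems apply without domains. The price
    is that the sign of an integrand is often known only for [t > 0]. *)

Definition halfline (R : realType) : set (measurableTypeR R) -> \bar R :=
  mrestr (@lebesgue_measure R) (measurable_itv `]0, +oo[).

HB.instance Definition _ (R : realType) := Measure.on (@halfline R).

Fact halfline_sigma_finite (R : realType) : sigma_finite setT (@halfline R).
Proof.
have /sigma_finiteP[F [TF ndF Foo]] := sigma_finiteT (@lebesgue_measure R).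
exists F => // k; have [mF ltF] := Foo k; split => //.
apply: le_lt_trans ltF; apply: le_measure; rewrite ?inE//.
by apply: measurableI => //; exact: measurable_itv.
Qed.

HB.instance Definition _ (R : realType) :=
  Measure_isSigmaFinite.Build _ _ _ (@halfline R) (@halfline_sigma_finite R).

(** A name for the product, so that a sigma-finite instance can be attached to it and Fubini applied
    to it against [halfline]. *)
Definition lebesgue4 (R : realType) : set (plane R * plane R) -> \bar R :=
  (@lebesgue2 R \x @lebesgue2 R)%E.

HB.instance Definition _ (R : realType) := Measure.on (@lebesgue4 R).

Section products.
Context d1 d2 (T1 : measurableType d1) (T2 : measurableType d2) (R : realType).
Variable m1 : {sigma_finite_measure set T1 -> \bar R}.
Variable m2 : {sigma_finite_measure set T2 -> \bar R}.

Lemma product_sigma_finite : sigma_finite setT (m1 \x m2)%E.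
Proof.
have /sigma_finiteP[F [TF ndF Foo]] := sigma_finiteT m1.
have /sigma_finiteP[G [TG ndG Goo]] := sigma_finiteT m2.
exists (fun n => F n `*` G n).
  rewrite -setXTT TF TG predeqE => -[x y]; split.
    move=> [/= [n _ Fnx] [k _ Gky]]; exists (maxn n k) => //; split.
    - by move: x Fnx; exact/subsetPset/ndF/leq_maxl.
    - by move: y Gky; exact/subsetPset/ndG/leq_maxr.
  by move=> [n _ []/= ? ?]; split; exists n.
move=> k; have [? ?] := Foo k; have [? ?] := Goo k.
split; first exact: measurableX.
by rewrite product_measure1E// lte_mul_pinfty// ge0_fin_numE.
Qed.

End products.

HB.instance Definition _ (R : realType) :=
  Measure_isSigmaFinite.Build _ _ _ (@lebesgue4 R)
    (product_sigma_finite (@lebesgue2 R) (@lebesgue2 R)).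


(** * Measurability of elementary expressions *)

Section measurability.
Context d (T : measurableType d) (R : realType).
Implicit Types f g : T -> R.

Lemma measurable_funexp f : measurable_fun setT f ->
  measurable_fun setT (fun x => expR (f x)).
Proof. by move=> mf; apply: (measurableT_comp (@measurable_expR R)). Qed.

Lemma measurable_funln f : measurable_fun setT f ->
  measurable_fun setT (fun x => ln (f x)).
Proof. by move=> mf; apply: (measurableT_comp (@measurable_ln R)). Qed.

Lemma measurable_funinv f : measurable_fun setT f ->
  measurable_fun setT (fun x => (f x)^-1).
Proof.
move=> mf.
(* the factor [f x] makes both sides vanish where [f] does *)
rewrite (_ : (fun _ => _) = (fun x => f x * (f x ^+ 2) `^ (-1))); last first.
  apply/funext => x; rewrite powR_inv1 ?sqr_ge0//.
  have [->|fx0] := eqVneq (f x) 0; first by rewrite invr0 mul0r.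
  by rewrite expr2 invfM mulrA divff// mul1r.
apply: measurable_funM => //.
apply: (measurableT_comp (measurable_powR (-1))).
exact: measurable_funX.
Qed.

(** Range conditions such as [a < r] enter the integrands below as 0-1 factors, so that they stay
    jointly measurable when integrals are exchanged. *)
Lemma measurable_fun_ltr_nat f g : measurable_fun setT f ->
  measurable_fun setT g -> measurable_fun setT (fun x => ((f x < g x)%R)%:R : R).
Proof.
move=> mf mg.
rewrite (_ : (fun _ => _) = (fun x => if f x < g x then 1 else 0 : R)).
  by apply: measurable_fun_ifT => //; exact: measurable_fun_ltr.
by apply/funext => x; case: (_ < _).
Qed.

End measurability.

Ltac meas := repeat
  match goal with
  | |- _ => assumption
  | |- measurable_fun _ (fun x => x) => exact: measurable_id
  | |- measurable_fun _ (fun _ => ?c) => exact: measurable_cst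
  | |- measurable_fun _ (fun x => (@?f x)%:E) => apply/measurable_EFinP; simpl
  | |- measurable_fun _ (EFin \o _) => apply/measurable_EFinP; simpl
  | |- measurable_fun _ (fun x => (nat_of_bool (@?f x < @?g x)%R)%:R) =>
      apply: measurable_fun_ltr_nat
  | |- measurable_fun _ (fun x => (@?f x) * (@?g x)) => apply: measurable_funM
  | |- measurable_fun _ (fun x => (@?f x) - (@?g x)) => apply: measurable_funB
  | |- measurable_fun _ (fun x => (@?f x) + (@?g x)) => apply: measurable_funD
  | |- measurable_fun _ (fun x => - (@?f x)) => apply: measurable_funN
  | |- measurable_fun _ (fun x => (@?f x) ^+ _) => apply: measurable_funX
  | |- measurable_fun _ (fun x => (@?f x)^-1) => apply: measurable_funinv
  | |- measurable_fun _ (fun x => expR (@?f x)) => apply: measurable_funexp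
  | |- measurable_fun _ (fun x => ln (@?f x)) => apply: measurable_funln
  | |- measurable_fun _ (fun x => (@?f x).1) =>
      apply: (measurableT_comp measurable_fst)
  | |- measurable_fun _ (fun x => (@?f x).2) =>
      apply: (measurableT_comp measurable_snd)
  | |- measurable_fun _ (+%R ?c) =>
      apply: (measurable_funD (measurable_cst c) (@measurable_id _ _ _))
  | |- measurable_fun _ ( *%R ?c) =>
      apply: (measurable_funM (measurable_cst c) (@measurable_id _ _ _))
  | |- measurable_fun _ (@GRing.inv _) =>
      apply: (measurable_funinv (@measurable_id _ _ _))
  | |- measurable_fun _ (@expR _) => exact: measurable_expR
  | |- measurable_fun _ fst => exact: measurable_fst
  | |- measurable_fun _ snd => exact: measurable_snd
  end.

Lemma ae_mono d (T : measurableType d) (R : realType)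
    (m : {measure set T -> \bar R}) (P Q : T -> Prop) :
  (forall x, P x -> Q x) -> {ae m, forall x, P x} -> {ae m, forall x, Q x}.
Proof. by move=> PQ; apply: filterS. Qed.

(* [is_derive] is a type class; the synonym keeps instance search away from
   the subgoals of the rules below. *)
Definition has_deriv (R : realType) (f : R -> R) (x a : R) : Prop :=
  is_derive x 1 f a.

Lemma ge0_integral_scale d (T : measurableType d) (R : realType)
    (m : {measure set T -> \bar R}) (k : R) (f g : T -> R) :
  0 <= k -> measurable_fun setT f -> (forall x, 0 <= f x) ->
  (forall x, g x = k * f x) ->
  (\int[m]_x (g x)%:E = k%:E * \int[m]_x (f x)%:E)%E.
Proof.
move=> k0 mf f0 gE; rewrite -ge0_integralZl//.
- by apply: eq_integral => x _; rewrite gE EFinM.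
- exact/measurable_EFinP.
- by move=> x _; rewrite lee_fin.
Qed.

Lemma ge0_integrable d (T : measurableType d) (R : realType)
    (m : {measure set T -> \bar R}) (f : T -> R) (c : R) :
  measurable_fun setT f -> (forall x, 0 <= f x) ->
  (\int[m]_x (f x)%:E <= c%:E)%E -> m.-integrable setT (EFin \o f).
Proof.
move=> mf f0 fc; apply/integrableP; split; first exact/measurable_EFinP.
rewrite (_ : integral _ _ _ = \int[m]_x (f x)%:E)%E.
  by rewrite (le_lt_trans fc) ?ltry.
by apply: eq_integral => x _; rewrite /= ger0_norm.
Qed.

Section halfline_theory.
Context {R : realType}.
Local Notation hl := (@halfline R).
Local Notation mu := (@lebesgue_measure R).
Local Open Scope ereal_scope.
Implicit Types f g : R -> \bar R.

Lemma halfline_gt0 : {ae hl, forall t : R, (0 < t)%R}.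
Proof.
exists (~` `]0%R, +oo[%classic); split.
- by apply: measurableC; exact: measurable_itv.
- by rewrite /halfline /mrestr setICl measure0.
- by apply: subsetC => t/=; rewrite in_itv/= andbT.
Qed.

Lemma ge0_integral_halfline f : measurable_fun setT f -> (forall t, 0 <= f t) ->
  \int[hl]_t f t = \int[mu]_(t in `]0%R, +oo[) f t.
Proof.
move=> mf f0.
transitivity (\int[hl]_t (f \_ `]0%R, +oo[) t).
  apply: ge0_ae_eq_integral => //.
  - apply/(measurable_restrictT _ _).1 => //; exact: measurable_funTS.
  - by move=> t _; rewrite patchE; case: ifP.
  - apply: ae_mono halfline_gt0 => t t0 _.
    by rewrite patchE mem_set//= in_itv/= t0.
rewrite -integral_mkcond.
apply: eq_measure_integral => A mA AD.
by rewrite -[LHS]/(mu (A `&` `]0%R, +oo[%classic)) setIidl.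
Qed.


(** The integral of a nonnegative function is a supremum over simple functions, and cutting a simple
    function to the half-line does not change its integral. This argument covers inner integrals
    whose measurability in the outer variable has not been established. *)
Lemma eq_halfline f g : (forall t, (0 < t)%R -> f t = g t) ->
  \int[hl]_t f t = \int[hl]_t g t.
Proof.
have key f1 f2 : (forall t, 0 <= f1 t) -> (forall t, 0 <= f2 t) ->
    (forall t, (0 < t)%R -> f1 t = f2 t) ->
    \int[hl]_t f1 t <= \int[hl]_t f2 t.
  move=> f10 f20 f12; rewrite ge0_integralTE// ge0_integralTE//.
  apply: ub_ereal_sup => _ [h hf1 <-].
  pose D : set (measurableTypeR R) := `]0%R, +oo[%classic.
  have mD : measurable D by exact: measurable_itv.
  apply: ereal_sup_ubound; exists (proj_nnsfun h mD) => [t|].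
    rewrite -mrestrict patchE; case: ifPn => [|_]; last exact: f20.
    by rewrite inE /D/= in_itv/= andbT => t0; rewrite -f12.
  rewrite /sintegral; apply: eq_fsbigr => r _.
  have [->|r0] := eqVneq r 0%R; first by rewrite !mul0e.
  congr (_ * _).
  rewrite -[LHS]/(mu (_ `&` D)) -[RHS]/(mu (_ `&` D)); congr (mu _).
  by apply/seteqP; split => t [/= + Dt]; rewrite mindicE mem_set// mulr1.
have {}key f1 f2 : (forall t, 0 <= f1 t) -> (forall t, 0 <= f2 t) ->
    (forall t, (0 < t)%R -> f1 t = f2 t) ->
    \int[hl]_t f1 t = \int[hl]_t f2 t.
  by move=> f10 f20 f12; apply/eqP; rewrite eq_le !key// => t /f12.
move=> fg; rewrite integralE [RHS]integralE; congr (_ - _); apply: key => //.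
- by move=> t t0; rewrite !funeposE fg.
- by move=> t t0; rewrite !funenegE fg.
Qed.

(** Factors such as [1 / t] give a sign only for [t > 0]. Absolute values agree with the functions
    there and are nonnegative everywhere, as the general theorems demand; the lemmas that follow use
    the same device. *)
Lemma ge0_le_halfline f g : measurable_fun setT f -> measurable_fun setT g ->
  (forall t, (0 < t)%R -> 0 <= f t <= g t) ->
  \int[hl]_t f t <= \int[hl]_t g t.
Proof.
move=> mf mg fg.
rewrite (@eq_halfline f (fun t => `|f t|)); last first.
  by move=> t /fg/andP[f0 _]; rewrite /= gee0_abs.
(* The maximum equals [g] for [t > 0] and dominates [|f|] for every [t]. *)
rewrite (@eq_halfline g (fun t => maxe `|f t| `|g t|)); last first.
  move=> t /fg/andP[f0 fg']; rewrite gee0_abs// gee0_abs ?(le_trans f0)//.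
  by rewrite max_r.
apply: ge0_le_integral => //.
- exact: measurableT_comp.
- by apply: measurable_maxe; exact: measurableT_comp.
- by move=> t _; rewrite le_max lexx.
Qed.

Lemma halfline_ge0 f : (forall t, (0 < t)%R -> 0 <= f t) ->
  0 <= \int[hl]_t f t.
Proof.
move=> f0; rewrite (@eq_halfline _ (fun t => `|f t|)) ?integral_ge0// => t t0.
by rewrite /= gee0_abs// f0.
Qed.

Lemma halflineD f g : measurable_fun setT f -> measurable_fun setT g ->
  (forall t, (0 < t)%R -> 0 <= f t) -> (forall t, (0 < t)%R -> 0 <= g t) ->
  \int[hl]_t (f t + g t) = \int[hl]_t f t + \int[hl]_t g t.
Proof.
move=> mf mg f0 g0.
rewrite (@eq_halfline f (fun t => `|f t|)); last first.
  by move=> t /f0 ?; rewrite /= gee0_abs.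
rewrite (@eq_halfline g (fun t => `|g t|)); last first.
  by move=> t /g0 ?; rewrite /= gee0_abs.
rewrite -ge0_integralD//; last 2 first.
- exact: measurableT_comp.
- exact: measurableT_comp.
by apply: eq_halfline => t t0 /=; rewrite !gee0_abs ?f0 ?g0.
Qed.

Lemma halflineZl f (k : R) : measurable_fun setT f -> (0 <= k)%R ->
  (forall t, (0 < t)%R -> 0 <= f t) ->
  \int[hl]_t (k%:E * f t) = k%:E * \int[hl]_t f t.
Proof.
move=> mf k0 f0.
rewrite (@eq_halfline f (fun t => `|f t|)); last first.
  by move=> t /f0 ?; rewrite /= gee0_abs.
rewrite -ge0_integralZl//; last exact: measurableT_comp.
by apply: eq_halfline => t t0 /=; rewrite gee0_abs ?f0.
Qed.

Section tonelli.
Context d (T : measurableType d).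
Variable m : {sigma_finite_measure set T -> \bar R}.

Lemma halfline_tonelli (f : T * R -> \bar R) : measurable_fun setT f ->
  (forall x t, (0 < t)%R -> 0 <= f (x, t)) ->
  \int[m]_x \int[hl]_t f (x, t) = \int[hl]_t \int[m]_x f (x, t).
Proof.
move=> mf f0.
transitivity (\int[m]_x \int[hl]_t `|f (x, t)|).
  apply: eq_integral => x _; apply: eq_halfline => t t0 /=.
  by rewrite gee0_abs// f0.
transitivity (\int[hl]_t \int[m]_x `|f (x, t)|).
  apply: (@fubini_tonelli _ _ _ _ R m (@halfline R) (fun z => `|f z|)).
    exact: measurableT_comp.
  by move=> z; exact: abse_ge0.
apply: eq_halfline => t t0; apply: eq_integral => x _ /=.
by rewrite gee0_abs// f0.
Qed.

End tonelli.

Lemma halfline_tonelli2 (f : R * R -> \bar R) : measurable_fun setT f ->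
  (forall s t, (0 < s)%R -> (0 < t)%R -> 0 <= f (s, t)) ->
  \int[hl]_s \int[hl]_t f (s, t) = \int[hl]_t \int[hl]_s f (s, t).
Proof.
move=> mf f0.
transitivity (\int[hl]_s \int[hl]_t `|f (s, t)|).
  apply: eq_halfline => s s0; apply: eq_halfline => t t0 /=.
  by rewrite gee0_abs// f0.
transitivity (\int[hl]_t \int[hl]_s `|f (s, t)|).
  apply: (@fubini_tonelli _ _ _ _ R (@halfline R) (@halfline R)
    (fun z => `|f z|)).
    exact: measurableT_comp.
  by move=> z; exact: abse_ge0.
apply: eq_halfline => t t0; apply: eq_halfline => s s0 /=.
by rewrite gee0_abs// f0.
Qed.

Lemma has_deriv_continuous (F : R -> R) (x a : R) : has_deriv F x a ->
  {for x, continuous F}.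
Proof.
move=> [dF _]; apply: differentiable_continuous.
exact/derivable1_diffP.
Qed.

Lemma halfline_FTC (F f : R -> R) (a b : R) : (0 <= a)%R -> (a <= b)%R ->
  measurable_fun setT f -> (forall r, (a < r < b)%R -> (0 <= f r)%R) ->
  (forall r, (a <= r <= b)%R ->
    has_deriv F r (f r) /\ {for r, continuous f}) ->
  \int[hl]_r (((a < r)%R)%:R * ((r < b)%R)%:R * f r)%:E = (F b - F a)%:E.
Proof.
move=> a0 ab mf f0 dcF.
have dF r : (a <= r <= b)%R -> is_derive r 1%R F (f r) by move=> /dcF[].
have cf r : (a <= r <= b)%R -> {for r, continuous f} by move=> /dcF[].
rewrite ge0_integral_halfline; last 2 first.
- by meas.
- move=> r; rewrite lee_fin.
  have [ar|] := boolP (a < r)%R; last by rewrite !mul0r.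
  have [rb|] := boolP (r < b)%R; last by rewrite mulr0 mul0r.
  by rewrite !mul1r f0// ar.
have [ba|nab] := eqVneq a b.
  rewrite ba subrr integral0_eq// => r _.
  by case: ltgtP; rewrite ?mul0r ?mulr0 ?mul0r.
have {nab} ab' : (a < b)%R by rewrite lt_neqAle nab.
transitivity (\int[mu]_(r in `]a, b[) (f r)%:E).
  rewrite integral_mkcond [RHS]integral_mkcond.
  apply: eq_integral => r _; rewrite !patchE !mem_setE !in_itv/= andbT.
  have [ar|] := ltP a r.
    rewrite (le_lt_trans a0 ar).
    by case: ltP => _ /=; rewrite ?mulr0 ?mulr1 ?mul0r ?mul1r.
  by rewrite !mul0r; case: ifP.
rewrite -(@integral_itv_bndoo _ _ _ _ true false); last first.
  by apply/measurable_EFinP; exact: measurable_funTS.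
rewrite (@continuous_FTC2 _ f F)// ?EFinB//.
- apply: continuous_in_subspaceT => r; rewrite inE/= in_itv/= => rab.
  exact: cf.
- split.
  + move=> r; rewrite in_itv/= => /andP[ar rb].
    by have [] : is_derive r 1%R F (f r) by apply: dF; rewrite !ltW.
  + apply: cvg_at_right_filter; apply: (@has_deriv_continuous _ _ (f a)).
    by apply: dF; rewrite lexx.
  + apply: cvg_at_left_filter; apply: (@has_deriv_continuous _ _ (f b)).
    by apply: dF; rewrite lexx andbT.
- move=> r; rewrite in_itv/= => /andP[ar rb]; rewrite derive1E.
  by have [] : is_derive r 1%R F (f r) by apply: dF; rewrite !ltW.
Qed.

Lemma halfline_FTCy (F f : R -> R) (a l : R) : (0 <= a)%R ->
  measurable_fun setT f -> (forall r, (a <= r)%R -> (0 <= f r)%R) ->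
  (forall r, (a <= r)%R -> has_deriv F r (f r) /\ {for r, continuous f}) ->
  F r @[r --> +oo%R] --> l ->
  \int[hl]_r (((a < r)%R)%:R * f r)%:E = (l - F a)%:E.
Proof.
move=> a0 mf f0 dcF Fl.
have dF r : (a <= r)%R -> is_derive r 1%R F (f r) by move=> /dcF[].
have cf r : (a <= r)%R -> {for r, continuous f} by move=> /dcF[].
rewrite ge0_integral_halfline; last 2 first.
- by meas.
- move=> r; rewrite lee_fin.
  have [ar|] := boolP (a < r)%R; last by rewrite !mul0r.
  by rewrite !mul1r f0// ltW.
transitivity (\int[mu]_(r in `]a, +oo[) (f r)%:E).
  rewrite integral_mkcond [RHS]integral_mkcond.
  apply: eq_integral => r _; rewrite !patchE !mem_setE !in_itv/= !andbT.
  have [ar|] := ltP a r.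
    by rewrite (le_lt_trans a0 ar) mul1r.
  by rewrite !mul0r; case: ifP.
rewrite integral_itv_obnd_cbnd; last first.
  by apply/measurable_EFinP; exact: measurable_funTS.
rewrite (@ge0_continuous_FTC2y _ f F _ l)// ?EFinB//.
- apply: continuous_in_subspaceT => r; rewrite inE/= in_itv/= andbT => ar.
  exact: cf.
- by move=> r /ltW/dF[].
- by apply: cvg_at_right_filter; exact: (has_deriv_continuous (dF _ (lexx a))).
- move=> r; rewrite in_itv/= andbT => /ltW ar; rewrite derive1E.
  by have [] := dF _ ar.
Qed.

End halfline_theory.

(** * Elementary integrals and Frullani's formula *)

Section derivation_rules.
Context {R : realType}.
Implicit Types (f g : R -> R) (x a b : R).

Lemma has_deriv_eq f x a b : has_deriv f x a -> a = b -> has_deriv f x b.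
Proof. by move=> + <-. Qed.

Lemma has_deriv_cst x a : has_deriv (fun=> a) x 0.
Proof. exact: is_derive_cst. Qed.

Lemma has_deriv_id x : has_deriv (fun y => y) x 1.
Proof. exact: is_derive_id. Qed.

Lemma has_derivD f g x a b : has_deriv f x a -> has_deriv g x b ->
  has_deriv (fun y => f y + g y) x (a + b).
Proof. exact: is_deriveD. Qed.

Lemma has_derivN f x a : has_deriv f x a -> has_deriv (fun y => - f y) x (- a).
Proof. exact: is_deriveN. Qed.

Lemma has_derivM f g x a b : has_deriv f x a -> has_deriv g x b ->
  has_deriv (fun y => f y * g y) x (f x * b + g x * a).
Proof. exact: is_deriveM. Qed.

Lemma has_deriv_sqr f x a : has_deriv f x a ->
  has_deriv (fun y => f y ^+ 2) x (f x * a + f x * a).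
Proof. by move=> fa; exact: has_derivM. Qed.

Lemma has_derivV f x a : f x != 0 -> has_deriv f x a ->
  has_deriv (fun y => (f y)^-1) x (- (f x) ^- 2 * a).
Proof. exact: is_deriveV. Qed.

Lemma has_deriv_expR f x a : has_deriv f x a ->
  has_deriv (fun y => expR (f y)) x (a * expR (f x)).
Proof.
move=> fa; rewrite mulrC.
exact: (@is_derive1_comp _ _ _ _ _ _ (is_derive_expR _) fa).
Qed.

Lemma has_deriv_ln f x a : 0 < f x -> has_deriv f x a ->
  has_deriv (fun y => ln (f y)) x (a / f x).
Proof.
move=> fx0 fa; rewrite mulrC.
exact: (@is_derive1_comp _ _ _ _ _ _ (is_derive1_ln fx0) fa).
Qed.

End derivation_rules.

Ltac der := repeat first
  [ apply: has_deriv_id | apply: has_deriv_cst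
  | apply: has_derivN | apply: has_derivD
  | apply: has_deriv_expR | apply: has_deriv_ln
  | apply: has_deriv_sqr | apply: has_derivV | apply: has_derivM ].

Section elementary_integrals.
Context {R : realType}.
Local Notation hl := (@halfline R).

Lemma cvg_expRNM (c : R) : 0 < c -> expR (- (c * t)) @[t --> +oo] --> (0 : R).
Proof.
move=> c0; apply: (cvg_comp (fun t => c * t) (fun t => expR (- t))); last first.
  exact: cvgr_expR.
by apply: gt0_cvgMry => //; exact: cvg_id.
Qed.

Lemma cvg_inv1D : (1 + t)^-1 @[t --> +oo] --> (0 : R).
Proof.
have p : \forall t \near +oo, 0 < 1 + t :> R.
  by near=> t; rewrite ltr_wpDr//; near: t; exact: nbhs_pinfty_ge.
exact: (proj2 (gtr0_cvgV0 p) (cvg_addrl _)).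
Unshelve. all: by end_near. Qed.

Lemma integral_gt_expN (c u : R) : 0 < c -> 0 <= u ->
  (\int[hl]_t ((u < t)%R%:R * expR (- (c * t)))%:E = (expR (- (c * u)) / c)%:E)%E.
Proof.
move=> c0 u0.
rewrite (@halfline_FTCy R (fun t => - (expR (- (c * t)) / c))
  (fun t => expR (- (c * t))) u 0)//.
- by rewrite sub0r opprK.
- by meas.
- move=> t _; split; last by apply: has_deriv_continuous; der.
  apply: has_deriv_eq; first by der.
  by rewrite /=; field; rewrite gt_eqF.
- rewrite -oppr0 -[X in - X](mul0r c^-1).
  by apply: cvgN; apply: cvgMl; exact: cvg_expRNM.
Qed.

Lemma integral_expN (c : R) : 0 < c ->
  (\int[hl]_t (expR (- (c * t)))%:E = (c^-1)%:E)%E.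
Proof.
move=> c0; rewrite -[RHS](_ : (expR (- (c * 0)) / c)%:E = _).
  rewrite -(@integral_gt_expN c 0)//; apply: eq_halfline => t t0.
  by rewrite t0 mul1r.
by rewrite mulr0 oppr0 expR0 mul1r.
Qed.

(** Layer cake in place of integration by parts: [t] is the length of []0, t[], and exchanging the
    integrals leaves tails of the exponential. *)
Lemma integral_idM_expN (c : R) : 0 < c ->
  (\int[hl]_t (t * expR (- (c * t)))%:E = (c ^- 2)%:E)%E.
Proof.
move=> c0.
transitivity (\int[hl]_t \int[hl]_u ((u < t)%R%:R * expR (- (c * t)))%:E)%E.
  apply: eq_halfline => t t0.
  under eq_integral do rewrite mulrC EFinM.
  rewrite halflineZl ?expR_ge0//; last by meas.
  have := @halfline_FTC R id (cst 1) 0 t.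
  under eq_integral do rewrite mulr1.
  rewrite subr0 mulrC EFinM => <-//; last 2 first.
  - exact: ltW.
  - by move=> r _; split; [der|exact: cst_continuous].
  by congr (_ * _)%E; apply: eq_halfline => u u0; rewrite u0 mul1r.
rewrite (halfline_tonelli2 (f := fun z =>
  ((z.2 < z.1)%R%:R * expR (- (c * z.1)))%:E)); last 2 first.
- by meas.
- by move=> s t _ _; rewrite lee_fin mulr_ge0 ?ler0n ?expR_ge0.
under eq_integral => u _ do rewrite /=.
rewrite (@eq_halfline _ _ (fun u => (c^-1)%:E * (expR (- (c * u)))%:E)%E); last first.
  by move=> u u0; rewrite /= integral_gt_expN ?(ltW u0)// -EFinM mulrC.
rewrite halflineZl ?invr_ge0 ?(ltW c0)//; last by meas.
by rewrite integral_expN// -EFinM -expr2 exprVn.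
Qed.

Lemma integral_expNM_itv (a b t : R) : 0 <= a -> a <= b -> 0 < t ->
  (\int[hl]_r ((a < r)%R%:R * (r < b)%R%:R * expR (- (r * t)))%:E =
   ((expR (- (a * t)) - expR (- (b * t))) / t)%:E)%E.
Proof.
move=> a0 ab t0.
rewrite (@halfline_FTC R (fun r => - (expR (- (r * t)) / t))
  (fun r => expR (- (r * t))))//.
- by congr EFin; ring.
- by meas.
- move=> r _; split; last by apply: has_deriv_continuous; der.
  apply: has_deriv_eq; first by der.
  by rewrite /=; field; rewrite gt_eqF.
Qed.

(** The integrand is the integral of [e^{-r t}] over [r] in []a, b[]; integrating in [t] first
    leaves [1 / r]. *)
Lemma frullani (a b : R) : 0 < a -> a <= b ->
  (\int[hl]_t ((expR (- (a * t)) - expR (- (b * t))) / t)%:E = (ln b - ln a)%:E)%E.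
Proof.
move=> a0 ab.
rewrite -(@halfline_FTC _ (@ln R) (fun r => r^-1))//; last 4 first.
- exact: ltW.
- by meas.
- by move=> r /andP[ar _]; rewrite invr_ge0 (le_trans (ltW a0))// ltW.
- move=> r /andP[ar _]; have r0 := lt_le_trans a0 ar.
  by split; [exact: is_derive1_ln|apply: inv_continuous; rewrite gt_eqF].
rewrite (@eq_halfline _ _ (fun t => \int[hl]_r
    ((a < r)%R%:R * (r < b)%R%:R * expR (- (r * t)))%:E)%E); last first.
  by move=> t t0; rewrite integral_expNM_itv// ltW.
rewrite (halfline_tonelli2 (f := fun z =>
  ((a < z.2)%R%:R * (z.2 < b)%R%:R * expR (- (z.2 * z.1)))%:E)); last 2 first.
- by meas.
- by move=> s t _ _; rewrite lee_fin !mulr_ge0 ?ler0n ?expR_ge0.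
apply: eq_halfline => r r0 /=.
under eq_integral do rewrite EFinM.
rewrite halflineZl ?mulr_ge0 ?ler0n//; last by meas.
by rewrite integral_expN// -EFinM.
Qed.

End elementary_integrals.

(** * One-dimensional integrals behind the potential of the profile *)

Section special_integrals.
Context {R : realType}.
Local Notation hl := (@halfline R).

(** As [t] runs over the half-line, [tau = s t / (s + t)] increases from 0 to [s] with derivative
    [s^2 / (s + t)^2], so this is the integral of [e^{-r tau}] over []0, s[]. *)
Lemma integral_harmonic (s r : R) : 0 < s -> 0 < r ->
  (\int[hl]_t (s ^+ 2 / (s + t) ^+ 2 * expR (- (r * (s * t / (s + t)))))%:E =
   ((1 - expR (- (r * s))) / r)%:E)%E.
Proof.
move=> s0 r0.
have st0 (t : R) : 0 <= t -> s + t != 0 by move=> t0; rewrite gt_eqF// ltr_wpDr.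
transitivity (\int[hl]_t ((0 < t)%R%:R *
    (s ^+ 2 / (s + t) ^+ 2 * expR (- (r * (s * t / (s + t))))))%:E)%E.
  by apply: eq_halfline => t t0; rewrite t0 mul1r.
rewrite (@halfline_FTCy R (fun t => - (expR (- (r * (s * t / (s + t)))) / r))
  (fun t => s ^+ 2 / (s + t) ^+ 2 * expR (- (r * (s * t / (s + t)))))
  0 (- (expR (- (r * s)) / r))).
- by congr EFin; rewrite mulr0 mul0r mulr0 oppr0 expR0; ring.
- by [].
- by meas.
- by move=> t t0; rewrite mulr_ge0 ?expR_ge0// divr_ge0 ?sqr_ge0.
- move=> t t0; split.
    apply: has_deriv_eq; first by der; exact: st0.
    by rewrite /=; field; rewrite st0//= gt_eqF.
  apply: has_deriv_continuous.
  by der; rewrite ?sqrf_eq0 ?st0.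
- apply: cvgN; apply: cvgMl.
  apply: continuous_cvg; first exact: continuous_expR.
  apply: cvgN; apply: cvgMr.
  (* The form [s - s^2 / (s + t)] of [s t / (s + t)] makes the limit [s] visible. *)
  suff : s - s ^+ 2 * (s + t)^-1 @[t --> +oo] --> s - s ^+ 2 * 0.
    rewrite mulr0 subr0; apply: cvg_trans; apply: near_eq_cvg.
    near=> t; have /st0 : 0 <= t by near: t; exact: nbhs_pinfty_ge.
    by move=> st; field.
  apply: cvgB; first exact: cvg_cst.
  apply: cvgMr.
  have p : \forall t \near +oo, 0 < s + t :> R.
    by near=> t; rewrite ltr_wpDr//; near: t; exact: nbhs_pinfty_ge.
  exact: (proj2 (gtr0_cvgV0 p) (cvg_addrl _)).
Unshelve. all: by end_near. Qed.

(** The subtracted exponential is added to both sides, which keeps every integrand nonnegative; then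
    [1/r - 1/(r (1 + r)) = 1/(1 + r)]. *)
Lemma integral_expNM_onem (r : R) : 0 < r ->
  (\int[hl]_s (expR (- s) * ((1 - expR (- (r * s))) / r))%:E = ((1 + r)^-1)%:E)%E.
Proof.
move=> r0; have r10 : 0 < 1 + r by rewrite addr_gt0.
have : (\int[hl]_s (expR (- s) * ((1 - expR (- (r * s))) / r))%:E +
    \int[hl]_s ((r^-1)%:E * (expR (- ((1 + r) * s)))%:E) =
    \int[hl]_s ((r^-1)%:E * (expR (- (1 * s)))%:E))%E.
  rewrite -halflineD; last 4 first.
  - by meas.
  - by apply: measurable_funeM; meas.
  - move=> s s0; rewrite lee_fin mulr_ge0 ?expR_ge0// mulr_ge0 ?invr_ge0 ?(ltW r0)//.
    by rewrite subr_ge0 -expR0 ler_expR oppr_le0 mulr_ge0 ?ltW.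
  - by move=> s s0; rewrite -EFinM lee_fin mulr_ge0 ?expR_ge0 ?invr_ge0 ?ltW.
  apply: eq_halfline => s s0; rewrite -!EFinM -EFinD mul1r; congr EFin.
  have -> : expR (- ((1 + r) * s)) = expR (- s) * expR (- (r * s)).
    by rewrite -expRD; congr expR; ring.
  by field; exact: lt0r_neq0.
rewrite !halflineZl ?invr_ge0 ?(ltW r0)//; [|by meas..].
rewrite !integral_expN// -!EFinM => /(congr1 (fun x => x - (r^-1 / (1 + r))%:E)%E).
rewrite addeK// => ->.
by rewrite -EFinB; congr EFin; field; rewrite !gt_eqF.
Qed.

(** The double integral that [G(0) - G(x)] will produce with [q = |x|^2]. With
    [tau = s t / (s + t)], the last factor is [tau] times the integral of [e^{-r tau}] over [r] in
    []0, q[], and the prefactor times [tau] is [e^{-s}] times the derivative of [tau] in [t].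
    Integrating in [t], then in [s], leaves the integral of [1 / (1 + r)] over []0, q[]. *)
Lemma integral_potential_kernel (q : R) : 0 <= q ->
  (\int[hl]_t \int[hl]_s (expR (- s) * (s / (t * (s + t))) *
     (1 - expR (- (q * (s * t / (s + t))))))%:E = (ln (1 + q))%:E)%E.
Proof.
move=> q0.
have st0 (s t : R) : 0 < s -> 0 < t -> 0 < s + t by move=> *; exact: addr_gt0.
have tau0 (s t : R) : 0 < s -> 0 < t -> 0 < s * t / (s + t).
  by move=> s0 t0; rewrite divr_gt0 ?mulr_gt0 ?st0.
rewrite -(halfline_tonelli2 (f := fun z => (expR (- z.1) * (z.1 / (z.2 * (z.1 + z.2))) *
     (1 - expR (- (q * (z.1 * z.2 / (z.1 + z.2))))))%:E)); last 2 first.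
- by meas.
- move=> s t s0 t0; rewrite lee_fin /= mulr_ge0//.
    by rewrite mulr_ge0 ?expR_ge0// divr_ge0 ?mulr_ge0 ?ltW// st0.
  by rewrite subr_ge0 -expR0 ler_expR oppr_le0 mulr_ge0//; apply/ltW/tau0.
pose I r : R := (0 < r)%R%:R * (r < q)%R%:R.
transitivity (\int[hl]_s \int[hl]_r
    (I r * (expR (- s) * ((1 - expR (- (r * s))) / r)))%:E)%E.
  apply: eq_halfline => s s0.
  pose F (z : R * R) := (expR (- s) * (s ^+ 2 / (s + z.1) ^+ 2) *
    (I z.2 * expR (- (z.2 * (s * z.1 / (s + z.1))))))%:E.
  transitivity (\int[hl]_t \int[hl]_r F (t, r))%E.
    apply: eq_halfline => t t0; rewrite /F /=.
    under eq_integral do rewrite EFinM.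
    rewrite halflineZl; last 3 first.
    - by rewrite /I; meas.
    - by rewrite mulr_ge0 ?expR_ge0// divr_ge0 ?sqr_ge0.
    - by move=> r _; rewrite lee_fin /I !mulr_ge0 ?ler0n ?expR_ge0.
    rewrite integral_expNM_itv ?tau0// -EFinM; congr EFin.
    rewrite mul0r oppr0 expR0; field.
    by rewrite !gt_eqF// st0.
  rewrite halfline_tonelli2; last 2 first.
  - by rewrite /F /I; meas.
  - move=> t r _ _; rewrite lee_fin; apply: mulr_ge0.
      by rewrite mulr_ge0 ?expR_ge0// divr_ge0 ?sqr_ge0.
    by rewrite /I !mulr_ge0 ?ler0n ?expR_ge0.
  apply: eq_halfline => r r0; rewrite /F /=.
  transitivity (\int[hl]_t ((I r * expR (- s))%:E * (s ^+ 2 / (s + t) ^+ 2 *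
      expR (- (r * (s * t / (s + t)))))%:E))%E.
    by apply: eq_integral => t _; rewrite -EFinM; congr EFin; ring.
  rewrite halflineZl; last 3 first.
  - by meas.
  - by rewrite /I !mulr_ge0 ?ler0n ?expR_ge0.
  - by move=> t _; rewrite lee_fin mulr_ge0 ?expR_ge0// divr_ge0 ?sqr_ge0.
  by rewrite integral_harmonic// -EFinM mulrA.
rewrite (halfline_tonelli2 (f := fun z =>
  (I z.2 * (expR (- z.1) * ((1 - expR (- (z.2 * z.1))) / z.2)))%:E)); last 2 first.
- by rewrite /I; meas.
- move=> s r s0 r0; rewrite lee_fin mulr_ge0//= ?/I ?mulr_ge0 ?ler0n ?expR_ge0//.
    by rewrite subr_ge0 -expR0 ler_expR oppr_le0 mulr_ge0 ?ltW.
  by rewrite invr_ge0 ltW.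
transitivity (\int[hl]_r (I r * (1 + r)^-1)%:E)%E.
  apply: eq_halfline => r r0 /=.
  under eq_integral do rewrite EFinM.
  rewrite halflineZl; last 3 first.
  - by meas.
  - by rewrite /I !mulr_ge0 ?ler0n.
  - move=> s s0; rewrite lee_fin !mulr_ge0 ?expR_ge0 ?invr_ge0 ?(ltW r0)//.
    by rewrite subr_ge0 -expR0 ler_expR oppr_le0 mulr_ge0 ?ltW.
  by rewrite integral_expNM_onem// -EFinM.
rewrite (@halfline_FTC R (fun r => ln (1 + r)) (fun r => (1 + r)^-1))//.
- by rewrite addr0 ln1 subr0.
- by meas.
- by move=> r /andP[/ltW r0 _]; rewrite invr_ge0 addr_ge0.
- move=> r /andP[r0 _]; have r1 : 0 < 1 + r by rewrite ltr_wpDr.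
  split; last by apply: has_deriv_continuous; der; rewrite gt_eqF.
  by apply: has_deriv_eq; [der|rewrite /=; field; rewrite gt_eqF].
Qed.

Lemma integral_gt_sqrV1D (r : R) : 0 <= r ->
  (\int[hl]_v ((r < v)%R%:R * (1 + v) ^- 2)%:E = ((1 + r)^-1)%:E)%E.
Proof.
move=> r0; have v1 (v : R) : r <= v -> 1 + v != 0.
  by move=> rv; rewrite gt_eqF// ltr_wpDr// (le_trans r0).
rewrite (@halfline_FTCy R (fun v => - (1 + v)^-1) (fun v => (1 + v) ^- 2) r 0)//.
- by rewrite sub0r opprK.
- by meas.
- by move=> v _; rewrite invr_ge0 sqr_ge0.
- move=> v rv; split; last first.
    by apply: has_deriv_continuous; der; rewrite sqrf_eq0 v1.
  by apply: has_deriv_eq; [der; exact: v1|rewrite /=; field; exact: v1].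
- by rewrite -oppr0; apply: cvgN; exact: cvg_inv1D.
Qed.

(** [(1 + v)^-2] is the density of [v = |y|^2] under the profile of mass 1, so the integrals against
    it below are radial means. *)
Lemma integral_sqrV1D : (\int[hl]_v ((1 + v) ^- 2)%:E = 1)%E.
Proof.
have := @integral_gt_sqrV1D 0 (lexx _); rewrite addr0 invr1 => <-.
by apply: eq_halfline => v ->; rewrite mul1r.
Qed.

(** Here [ln (1 + v)] is the integral of [1 / (1 + r)] over [r < v]; after the exchange the tail of
    the density contributes a second factor [1 / (1 + r)]. *)
Lemma integral_sqrV1D_ln1D :
  (\int[hl]_v ((1 + v) ^- 2 * ln (1 + v))%:E = 1)%E.
Proof.
pose F (z : R * R) := ((z.2 < z.1)%R%:R * ((1 + z.1) ^- 2 * (1 + z.2)^-1))%:E.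
transitivity (\int[hl]_v \int[hl]_r F (v, r))%E.
  apply: eq_halfline => v v0; rewrite /F /=.
  transitivity (((1 + v) ^- 2)%:E *
      \int[hl]_r ((0 < r)%R%:R * (r < v)%R%:R * (1 + r)^-1)%:E)%E.
    rewrite (@halfline_FTC R (fun r => ln (1 + r)) (fun r => (1 + r)^-1))//.
    - by rewrite addr0 ln1 subr0.
    - exact: ltW.
    - by meas.
    - by move=> r /andP[/ltW r0 _]; rewrite invr_ge0 addr_ge0.
    - move=> r /andP[r0 _]; have r1 : 0 < 1 + r by rewrite ltr_wpDr.
      split; last by apply: has_deriv_continuous; der; rewrite gt_eqF.
      by apply: has_deriv_eq; [der|rewrite /=; field; rewrite gt_eqF].
  rewrite -halflineZl.
  - by apply: eq_halfline => r r0; rewrite r0 -EFinM mul1r; congr EFin; ring.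
  - by meas.
  - by rewrite invr_ge0 sqr_ge0.
  - by move=> r r0; rewrite lee_fin !mulr_ge0 ?ler0n// invr_ge0 addr_ge0// ltW.
rewrite halfline_tonelli2; last 2 first.
- by rewrite /F; meas.
- move=> v r v0 r0; rewrite lee_fin mulr_ge0 ?ler0n// mulr_ge0 ?invr_ge0 ?sqr_ge0//.
  by rewrite addr_ge0// ltW.
rewrite -integral_sqrV1D; apply: eq_halfline => r r0; rewrite /F /=.
transitivity (((1 + r)^-1)%:E * \int[hl]_v ((r < v)%R%:R * (1 + v) ^- 2)%:E)%E.
  rewrite -halflineZl.
  - by apply: eq_integral => v _; rewrite -EFinM; congr EFin; ring.
  - by meas.
  - by rewrite invr_ge0 addr_ge0// ltW.
  - by move=> v _; rewrite lee_fin mulr_ge0 ?ler0n ?invr_ge0 ?sqr_ge0.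
by rewrite integral_gt_sqrV1D ?(ltW r0)// -EFinM -invfM.
Qed.

Lemma integral_gt_VM1D (v : R) : 0 < v ->
  (\int[hl]_r ((v < r)%R%:R * (r * (1 + r))^-1)%:E = (ln (1 + v) - ln v)%:E)%E.
Proof.
move=> v0.
have r0 (r : R) : v <= r -> 0 < r by move=> vr; exact: lt_le_trans vr.
have r1 (r : R) : v <= r -> 0 < 1 + r by move=> /r0 ?; exact: addr_gt0.
rewrite (@halfline_FTCy R (fun r => ln r - ln (1 + r)) (fun r => (r * (1 + r))^-1) v 0).
- by congr EFin; ring.
- exact: ltW.
- by meas.
- move=> r vr; have ? := r0 _ vr; have ? := r1 _ vr.
  by rewrite invr_ge0 mulr_ge0 ?ltW.
- move=> r vr; have ? := r0 _ vr; have ? := r1 _ vr; split; last first.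
    by apply: has_deriv_continuous; der; rewrite mulf_neq0 ?gt_eqF.
  apply: has_deriv_eq; first by der.
  by rewrite /=; field; rewrite !gt_eqF.
- rewrite -[X in _ --> X]ln1.
  apply: (@cvg_trans _ (ln (1 - (1 + r)^-1) @[r --> +oo])).
    apply: near_eq_cvg; near=> r.
    have vr : v <= r by near: r; apply: nbhs_pinfty_ge; exact: num_real.
    have ? := r0 _ vr; have ? := r1 _ vr.
    by rewrite -ln_div ?posrE//; congr ln; field; rewrite gt_eqF.
  apply: continuous_cvg; first exact: (continuous_ln ltr01).
  by rewrite -[X in _ --> X]subr0; apply: cvgB; [exact: cvg_cst|exact: cvg_inv1D].
Unshelve. all: by end_near. Qed.

(** The logarithmic difference is the integral of [1 / (r (1 + r))] over [r > v]; after the exchange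
    the density has mass [r / (1 + r)] below [r], and the product is again [(1 + r)^-2]. *)
Lemma integral_sqrV1D_ln1DV :
  (\int[hl]_v ((1 + v) ^- 2 * (ln (1 + v) - ln v))%:E = 1)%E.
Proof.
pose F (z : R * R) := ((z.1 < z.2)%R%:R * ((1 + z.1) ^- 2 * (z.2 * (1 + z.2))^-1))%:E.
have rr (r : R) : 0 < r -> 0 <= (r * (1 + r))^-1.
  by move=> r0; rewrite invr_ge0 mulr_ge0 ?addr_ge0 ?ltW.
transitivity (\int[hl]_v \int[hl]_r F (v, r))%E.
  apply: eq_halfline => v v0; rewrite /F /=.
  rewrite EFinM -integral_gt_VM1D// -halflineZl.
  - by apply: eq_halfline => r r0; rewrite -EFinM; congr EFin; ring.
  - by meas.
  - by rewrite invr_ge0 sqr_ge0.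
  - by move=> r r0; rewrite lee_fin mulr_ge0 ?ler0n ?rr.
rewrite halfline_tonelli2; last 2 first.
- by rewrite /F; meas.
- move=> v r v0 r0; rewrite lee_fin mulr_ge0 ?ler0n//.
  by rewrite mulr_ge0 ?rr// invr_ge0 sqr_ge0.
rewrite -integral_sqrV1D; apply: eq_halfline => r r0; rewrite /F /=.
transitivity (((r * (1 + r))^-1)%:E *
    \int[hl]_v ((0 < v)%R%:R * (v < r)%R%:R * (1 + v) ^- 2)%:E)%E.
  rewrite -halflineZl.
  - by apply: eq_halfline => v v0; rewrite v0 -EFinM mul1r; congr EFin; ring.
  - by meas.
  - exact: rr.
  - by move=> v v0; rewrite lee_fin !mulr_ge0 ?ler0n// invr_ge0 sqr_ge0.
rewrite (@halfline_FTC R (fun v => - (1 + v)^-1) (fun v => (1 + v) ^- 2)).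
- by rewrite -EFinM addr0; congr EFin; field; rewrite !gt_eqF// addr_gt0.
- by [].
- exact: ltW.
- by meas.
- by move=> v _; rewrite invr_ge0 sqr_ge0.
- move=> v /andP[v0 _]; have v1 : 1 + v != 0 by rewrite gt_eqF// ltr_wpDr.
  split; last by apply: has_deriv_continuous; der; rewrite sqrf_eq0.
  by apply: has_deriv_eq; [der|rewrite /=; field].
Qed.

(** Both sides are iterated integrals of [s e^{-s} e^{-(s + t) v}], in the two orders. They are the
    mixture form and the radial form of [G(t, 0)]. *)
Lemma integral_expN_ratio (t : R) : 0 < t ->
  (\int[hl]_s (expR (- s) * (s / (s + t)))%:E =
   \int[hl]_v (expR (- (t * v)) * (1 + v) ^- 2)%:E)%E.
Proof.
move=> t0.
pose F (z : R * R) := (expR (- (t * z.2)) * (z.1 * expR (- ((1 + z.2) * z.1))))%:E.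
transitivity (\int[hl]_s \int[hl]_v F (s, v))%E.
  apply: eq_halfline => s s0; rewrite /F /=.
  transitivity ((expR (- s) * s)%:E * \int[hl]_v (expR (- ((s + t) * v)))%:E)%E.
    by rewrite integral_expN ?addr_gt0// -EFinM mulrA.
  rewrite -halflineZl ?mulr_ge0 ?expR_ge0 ?(ltW s0)//; last by meas.
  apply: eq_halfline => v _; rewrite -EFinM; congr EFin.
  rewrite mulrAC -expRD [RHS]mulrCA -expRD [RHS]mulrC; congr (expR _ * s).
  by ring.
rewrite halfline_tonelli2; last 2 first.
- by rewrite /F; meas.
- by move=> s v s0 v0; rewrite lee_fin !mulr_ge0 ?expR_ge0 ?(ltW s0).
apply: eq_halfline => v v0; rewrite /F /=.
under eq_integral do rewrite EFinM.
rewrite halflineZl ?expR_ge0//; [|by meas|].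
  by rewrite integral_idM_expN ?addr_gt0// -EFinM.
by move=> s s0; rewrite lee_fin mulr_ge0 ?expR_ge0// ltW.
Qed.

End special_integrals.

(** * Gaussians in the plane *)

Section gaussian.
Context {R : realType}.
Local Notation mu := (@lebesgue_measure R).
Local Notation l2 := (@lebesgue2 R).
Local Notation hl := (@halfline R).
Implicit Types x y z : plane R.

(** Squares are kept throughout, so that completing the square is a polynomial identity; the root in
    [enorm] returns only at the end, as a factor 2 in the logarithm. *)
Definition sqn x : R := x.1 ^+ 2 + x.2 ^+ 2.
Definition sqd x y : R := (x.1 - y.1) ^+ 2 + (x.2 - y.2) ^+ 2.

Lemma sqn_ge0 x : 0 <= sqn x. Proof. by rewrite addr_ge0 ?sqr_ge0. Qed.
Lemma sqd_ge0 x y : 0 <= sqd x y. Proof. by rewrite addr_ge0 ?sqr_ge0. Qed.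
Lemma sqdC x y : sqd x y = sqd y x. Proof. by rewrite /sqd; ring. Qed.
Lemma sqd0 y : sqd (0, 0) y = sqn y. Proof. by rewrite /sqd /sqn/=; ring. Qed.

Lemma sqd_gt0 x y : x <> y -> 0 < sqd x y.
Proof.
move=> xy; rewrite lt_neqAle sqd_ge0 andbT eq_sym; apply/eqP => /eqP.
rewrite paddr_eq0 ?sqr_ge0// !sqrf_eq0 !subr_eq0 => /andP[/eqP x1 /eqP x2].
by apply: xy; rewrite (surjective_pairing x) x1 x2 -surjective_pairing.
Qed.

Lemma enorm_sqr x : enorm x ^+ 2 = sqn x.
Proof. by rewrite sqr_sqrtr ?sqn_ge0. Qed.

Lemma integral_gauss1 (c m : R) : 0 < c ->
  (\int[mu]_y (expR (- (c * (y - m) ^+ 2)))%:E = (Num.sqrt (pi / c))%:E)%E.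
Proof.
(* The standard deviation for which [(y - m)^2 / (2 s^2)] is [c (y - m)^2]. *)
move=> c0; pose s := Num.sqrt ((c *+ 2)^-1).
have s0 : s != 0 by rewrite gt_eqF// sqrtr_gt0 invr_gt0 pmulrn_lgt0.
have s2 : s ^+ 2 = (c *+ 2)^-1 by rewrite sqr_sqrtr// invr_ge0 mulrn_wge0// ltW.
have pk : normal_peak s = (Num.sqrt (pi / c))^-1.
  rewrite /normal_peak s2; congr (Num.sqrt _)^-1.
  by field; rewrite gt_eqF.
have pk0 : normal_peak s != 0 by rewrite gt_eqF// normal_peak_gt0.
have : (\int[mu]_r ((normal_peak s)%:E * (expR (- (c * (r - m) ^+ 2)))%:E) = 1)%E.
  rewrite -(integral_normal_pdf m s); apply: eq_integral => r _.
  rewrite normal_pdfE// -EFinM; congr (_ * expR _)%:E.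
  by rewrite s2; field; rewrite gt_eqF.
rewrite ge0_integralZl ?lee_fin ?normal_peak_ge0//; last by meas.
move=> /(congr1 (fun u => (normal_peak s)^-1%:E * u)%E).
rewrite muleA -EFinM mulVf// mul1e mule1 => ->.
by rewrite pk invrK.
Qed.

Lemma integral_gauss (c : R) z : 0 < c ->
  (\int[l2]_y (expR (- (c * sqd y z)))%:E = (pi / c)%:E)%E.
Proof.
move=> c0.
rewrite -[LHS]/(\int[(mu \x mu)%E]_y (expR (- (c * sqd y z)))%:E)%E.
rewrite fubini_tonelli1; last 2 first.
- by rewrite /sqd; meas.
- by move=> y; rewrite lee_fin expR_ge0.
rewrite /fubini_F.
transitivity (\int[mu]_y1 ((Num.sqrt (pi / c))%:E *
    (expR (- (c * (y1 - z.1) ^+ 2)))%:E))%E.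
  apply: eq_integral => y1 _.
  rewrite -(integral_gauss1 z.2 c0) muleC -ge0_integralZl ?lee_fin ?expR_ge0//.
  - apply: eq_integral => y2 _; rewrite -EFinM -expRD /sqd/=.
    by congr (expR _)%:E; ring.
  - by meas.
rewrite ge0_integralZl ?lee_fin ?sqrtr_ge0//.
- rewrite integral_gauss1// -EFinM -expr2 sqr_sqrtr// divr_ge0 ?pi_ge0//.
  exact: ltW.
- by meas.
Qed.

Lemma integral_gaussM (s t : R) x z : 0 < s -> 0 < t ->
  (\int[l2]_y (expR (- (s * sqd y z)) * expR (- (t * sqd x y)))%:E =
   (pi / (s + t) * expR (- (sqd x z * (s * t / (s + t)))))%:E)%E.
Proof.
move=> s0 t0; have st0 : 0 < s + t by rewrite addr_gt0.
(* The barycentre of [z] and [x] with weights [s] and [t], about which the square is completed. *)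
pose m : plane R := ((s * z.1 + t * x.1) / (s + t), (s * z.2 + t * x.2) / (s + t)).
rewrite (@ge0_integral_scale _ _ _ _ (expR (- (sqd x z * (s * t / (s + t)))))
  (fun y => expR (- ((s + t) * sqd y m)))).
- by rewrite integral_gauss// -EFinM mulrC.
- exact: expR_ge0.
- by rewrite /sqd; meas.
- by move=> y; exact: expR_ge0.
- move=> y; rewrite -!expRD; congr expR.
  by rewrite /sqd /m/=; field; rewrite gt_eqF.
Qed.

Lemma lebesgue2_set1 x : l2 [set x] = 0%E.
Proof.
rewrite [X in l2 X](_ : _ = [set x.1] `*` [set x.2]).
  rewrite -[LHS]/((mu \x mu)%E _) product_measure1E//.
  by rewrite -[RHS](mul0e (mu [set x.2])); congr (_ * _)%E; exact: lebesgue_measure_set1.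
by apply/seteqP; split => [_ ->//|[a b]/= [-> ->]]; rewrite -surjective_pairing.
Qed.

Lemma ae_neq x : {ae l2, forall y, x <> y}.
Proof.
exists [set x]; split.
- rewrite [X in measurable X](_ : _ = [set x.1] `*` [set x.2]).
    by apply: measurableX; exact: measurable_set1.
  by apply/seteqP; split => [_ ->//|[a b]/= [-> ->]]; rewrite -surjective_pairing.
- exact: lebesgue2_set1.
- by move=> y /= /contrapT ->.
Qed.

Definition pstar x : R := (pi * (1 + sqn x) ^+ 2)^-1.

Lemma rho_starE (M : R) x : rho_star M x = M * pstar x.
Proof. by rewrite /rho_star enorm_sqr. Qed.

Lemma pstar_ge0 x : 0 <= pstar x.
Proof. by rewrite invr_ge0 mulr_ge0 ?pi_ge0 ?sqr_ge0. Qed.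

Lemma measurable_pstar : measurable_fun setT pstar.
Proof. by rewrite /pstar /sqn; meas. Qed.

Lemma pstar_mixture x :
  ((pstar x)%:E = \int[hl]_s (pi^-1 * (s * expR (- s)) * expR (- (s * sqn x)))%:E)%E.
Proof.
transitivity ((pi^-1 : R)%:E * \int[hl]_s (s * expR (- ((1 + sqn x) * s)))%:E)%E.
  by rewrite integral_idM_expN ?ltr_pwDl ?sqn_ge0// -EFinM -invfM.
rewrite -halflineZl ?invr_ge0 ?pi_ge0//.
- apply: eq_halfline => s _; rewrite -EFinM; congr EFin.
  by rewrite -!mulrA -expRD; congr (_ * (_ * expR _)); ring.
- by meas.
- by move=> s s0; rewrite lee_fin mulr_ge0 ?expR_ge0 ?ltW.
Qed.

Lemma integral_pstarM (h : plane R -> R) : measurable_fun setT h ->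
  (forall y, 0 <= h y) ->
  (\int[l2]_y (pstar y * h y)%:E = \int[hl]_s ((pi^-1 * (s * expR (- s)))%:E *
    \int[l2]_y (expR (- (s * sqn y)) * h y)%:E))%E.
Proof.
move=> mh h0.
pose F (z : plane R * R) :=
  (pi^-1 * (z.2 * expR (- z.2)) * (expR (- (z.2 * sqn z.1)) * h z.1))%:E.
have mF : measurable_fun setT F.
  have mh1 : measurable_fun setT (fun z : plane R * R => h z.1).
    exact: (measurableT_comp mh).
  by rewrite /F /sqn; meas.
have s0 (s : R) : 0 < s -> 0 <= pi^-1 * (s * expR (- s)).
  by move=> s0; rewrite !mulr_ge0 ?invr_ge0 ?pi_ge0 ?expR_ge0 ?ltW.
transitivity (\int[l2]_y \int[hl]_s F (y, s))%E.
  apply: eq_integral => y _; rewrite mulrC EFinM pstar_mixture -halflineZl//.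
  - by apply: eq_integral => s _; rewrite /F/= -EFinM; congr EFin; ring.
  - by meas.
  - by move=> s sp; rewrite lee_fin mulr_ge0 ?expR_ge0// s0.
rewrite (halfline_tonelli l2)//; last first.
  by move=> y s sp; rewrite lee_fin mulr_ge0 ?s0//= mulr_ge0 ?expR_ge0.
apply: eq_halfline => s sp; rewrite -ge0_integralZl ?lee_fin ?s0//.
- by rewrite /sqn; meas.
- by move=> y _; rewrite lee_fin mulr_ge0 ?expR_ge0.
Qed.

End gaussian.

(** * The logarithmic potential of the optimal profile *)

Section potential.
Context {R : realType}.
Local Notation mu := (@lebesgue_measure R).
Local Notation l2 := (@lebesgue2 R).
Local Notation hl := (@halfline R).
Local Notation "'p0'" := ((0, 0) : plane R).
Implicit Types (x y : plane R) (s t : R).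

Lemma integral_pstar : (\int[l2]_y (pstar y)%:E = 1)%E.
Proof.
transitivity (\int[l2]_y (pstar y * cst 1 y)%:E)%E.
  by apply: eq_integral => y _; rewrite mulr1.
rewrite integral_pstarM; [|by []|by move=> y; exact: ler01].
transitivity (\int[hl]_s (expR (- (1 * s)))%:E)%E; last first.
  by rewrite integral_expN// invr1.
apply: eq_halfline => s s0.
transitivity ((pi^-1 * (s * expR (- s)))%:E *
    \int[l2]_y (expR (- (s * sqd y p0)))%:E)%E.
  congr (_ * _)%E; apply: eq_integral => y _.
  by rewrite mulr1 sqdC sqd0.
rewrite integral_gauss// -EFinM mul1r; congr EFin.
by move: (@pi R) (pi_gt0 R) => p p_gt0; field; rewrite !gt_eqF.
Qed.

Definition Gstar t x : R := \int[l2]_y (pstar y * expR (- (t * sqd x y))).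

Lemma expRN_le1 (a : R) : 0 <= a -> expR (- a) <= 1.
Proof. by move=> a0; rewrite -expR0 ler_expR oppr_le0. Qed.

Lemma measurable_pstar_exp t x :
  measurable_fun setT (fun y => (pstar y * expR (- (t * sqd x y)))%:E).
Proof.
have mp := @measurable_pstar R.
by rewrite /sqd; meas.
Qed.

Lemma integral_pstar_exp_le1 t x : 0 <= t ->
  (\int[l2]_y (pstar y * expR (- (t * sqd x y)))%:E <= 1)%E.
Proof.
move=> t0; rewrite -integral_pstar; apply: ge0_le_integral.
- by [].
- by move=> y _; rewrite lee_fin mulr_ge0 ?pstar_ge0 ?expR_ge0.
- exact: measurable_pstar_exp.
- by apply/measurable_EFinP; exact: measurable_pstar.
- move=> y _; rewrite lee_fin ler_piMr ?pstar_ge0//.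
  by rewrite expRN_le1// mulr_ge0 ?sqd_ge0.
Qed.

Lemma EFin_Gstar t x : 0 <= t ->
  (Gstar t x)%:E = (\int[l2]_y (pstar y * expR (- (t * sqd x y)))%:E)%E.
Proof.
move=> t0; rewrite /Gstar /Rintegral fineK// ge0_fin_numE.
  by rewrite (le_lt_trans (integral_pstar_exp_le1 x t0)) ?ltry.
by apply: integral_ge0 => y _; rewrite lee_fin mulr_ge0 ?pstar_ge0 ?expR_ge0.
Qed.

Lemma Gstar_ge0 t x : 0 <= Gstar t x.
Proof.
by apply: Rintegral_ge0 => y _; rewrite mulr_ge0 ?pstar_ge0 ?expR_ge0.
Qed.

Lemma Gstar_le1 t x : 0 <= t -> Gstar t x <= 1.
Proof.
by move=> t0; rewrite -lee_fin EFin_Gstar// integral_pstar_exp_le1.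
Qed.

Lemma measurable_Gstar x : measurable_fun setT (fun t => Gstar t x).
Proof.
have mp1 : measurable_fun setT (fun z : plane R * R => pstar z.1).
  exact: (measurableT_comp (@measurable_pstar R)).
pose F (z : plane R * R) := (pstar z.1 * expR (- (z.2 * sqd x z.1)))%:E.
have mF : measurable_fun setT F by rewrite /F /sqd; meas.
have F0 z : (0 <= F z)%E by rewrite lee_fin mulr_ge0 ?pstar_ge0 ?expR_ge0.
have := measurable_fun_fubini_tonelli_G (m1 := l2) F mF F0.
exact: measurableT_comp.
Qed.

Lemma GstarE t x : 0 < t ->
  ((Gstar t x)%:E = \int[hl]_s (expR (- s) * (s / (s + t)) *
     expR (- (sqn x * (s * t / (s + t)))))%:E)%E.
Proof.
move=> t0; rewrite EFin_Gstar ?(ltW t0)//.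
rewrite (integral_pstarM (h := fun y => expR (- (t * sqd x y)))).
- apply: eq_halfline => s s0.
  transitivity ((pi^-1 * (s * expR (- s)))%:E *
    \int[l2]_y (expR (- (s * sqd y p0)) * expR (- (t * sqd x y)))%:E)%E.
    by congr (_ * _)%E; apply: eq_integral => y _; rewrite [sqd _ p0]sqdC sqd0.
  rewrite integral_gaussM// -EFinM sqdC sqd0; congr EFin.
  move: (@pi R) (pi_gt0 R) => p p_gt0.
  by field; rewrite !gt_eqF ?addr_gt0.
- by rewrite /sqd; meas.
- by move=> y; rewrite expR_ge0.
Qed.

Lemma sqn0 : sqn p0 = 0. Proof. by rewrite /sqn/= expr0n addr0. Qed.

Lemma Gstar_increment t x : 0 < t ->
  (((Gstar t p0 - Gstar t x) / t)%:E =
   \int[hl]_s (expR (- s) * (s / (t * (s + t))) *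
     (1 - expR (- (sqn x * (s * t / (s + t))))))%:E)%E.
Proof.
move=> t0; set I := (\int[hl]_s _)%E.
have s1 s : 0 < s -> 0 <= expR (- s) * (s / (t * (s + t))) *
     (1 - expR (- (sqn x * (s * t / (s + t))))).
  move=> s0; rewrite mulr_ge0//.
    by rewrite mulr_ge0 ?expR_ge0// divr_ge0 ?mulr_ge0 ?addr_ge0 ?ltW.
  rewrite subr_ge0 expRN_le1// mulr_ge0 ?sqn_ge0//.
  by rewrite divr_ge0 ?mulr_ge0 ?addr_ge0 ?ltW.
(* In this additive form all three terms are integrals of nonnegative functions. *)
suff : ((Gstar t x)%:E + t%:E * I = (Gstar t p0)%:E)%E.
  move=> h; have It : (t%:E * I = (Gstar t p0 - Gstar t x)%:E)%E.
    by rewrite EFinB -h addeAC subee// add0e.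
  by rewrite mulrC EFinM -It muleA -EFinM mulVf ?mul1e// gt_eqF.
rewrite GstarE// GstarE// /I -halflineZl; last 3 first.
- by meas.
- exact: ltW.
- exact: s1.
rewrite -halflineD.
- apply: eq_halfline => s s0; rewrite -EFinM -EFinD; congr EFin.
  by rewrite sqn0 mul0r oppr0 expR0; field; rewrite !gt_eqF ?addr_gt0.
- by meas.
- by apply: measurable_funeM; meas.
- move=> s s0; rewrite lee_fin mulr_ge0 ?expR_ge0//.
  by rewrite mulr_ge0 ?expR_ge0// divr_ge0 ?addr_ge0 ?ltW.
- by move=> s s0; rewrite -EFinM lee_fin mulr_ge0 ?s1 ?(ltW t0).
Qed.

Lemma Gstar0E t : 0 < t ->
  ((Gstar t p0)%:E = \int[hl]_v (expR (- (t * v)) * (1 + v) ^- 2)%:E)%E.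
Proof.
move=> t0; rewrite -integral_expN_ratio// GstarE//.
by apply: eq_halfline => s s0; rewrite sqn0 mul0r oppr0 expR0 mulr1.
Qed.

Lemma integrable_pstar : l2.-integrable setT (fun y => (pstar y)%:E).
Proof.
apply/integrableP; split.
  by apply/measurable_EFinP; exact: measurable_pstar.
rewrite (_ : (\int[l2]_y _)%E = \int[l2]_y (pstar y)%:E)%E.
  by rewrite integral_pstar ltry.
by apply: eq_integral => y _; rewrite gee0_abs ?lee_fin ?pstar_ge0.
Qed.

Lemma integral_pstar_onem t x : 0 < t ->
  (\int[l2]_y (pstar y * (1 - expR (- (t * sqd x y))))%:E = (1 - Gstar t x)%:E)%E.
Proof.
move=> t0; rewrite EFinB -integral_pstar EFin_Gstar ?(ltW t0)//.
rewrite -integralB.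
- by apply: eq_integral => y _; rewrite -EFinB mulrBr mulr1.
- by [].
- exact: integrable_pstar.
- apply: (le_integrable _ (measurable_pstar_exp t x) _ integrable_pstar) => // y _.
  rewrite !gee0_abs ?lee_fin ?mulr_ge0 ?pstar_ge0 ?expR_ge0//.
  rewrite ler_piMr ?pstar_ge0// expRN_le1// mulr_ge0 ?sqd_ge0//.
  exact: ltW.
Qed.

Lemma frullani_ge0 (a b t : R) : 0 < t -> a <= b ->
  0 <= (expR (- (a * t)) - expR (- (b * t))) / t.
Proof.
move=> t0 ab; rewrite divr_ge0 ?(ltW t0)//.
by rewrite subr_ge0 ler_expR lerN2 ler_wpM2r// ltW.
Qed.

(** Frullani's kernel between 1 and [1 + d2] factors as [e^{-t} / t] times [1 - e^{-t d2}]. *)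
Lemma integral_pstar_ln1D x :
  (\int[l2]_y (pstar y * ln (1 + sqd x y))%:E =
   \int[hl]_t (expR (- t) / t * (1 - Gstar t x))%:E)%E.
Proof.
have mp1 : measurable_fun setT (fun z : plane R * R => pstar z.1).
  exact: (measurableT_comp (@measurable_pstar R)).
have mp := @measurable_pstar R.
pose F (z : plane R * R) := (pstar z.1 *
  ((expR (- (1 * z.2)) - expR (- ((1 + sqd x z.1) * z.2))) / z.2))%:E.
have le1 y : 1 <= 1 + sqd x y by rewrite lerDl sqd_ge0.
have mF : measurable_fun setT F by rewrite /F /sqd; meas.
transitivity (\int[l2]_y \int[hl]_t F (y, t))%E.
  apply: eq_integral => y _; rewrite /F/= EFinM.
  rewrite -[ln _](subr0) -ln1 -frullani// -halflineZl ?pstar_ge0//.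
  - by meas.
  - by move=> t t0; rewrite lee_fin frullani_ge0.
rewrite (halfline_tonelli l2); last 2 first.
- exact: mF.
- by move=> y t t0; rewrite lee_fin mulr_ge0 ?pstar_ge0// frullani_ge0.
apply: eq_halfline => t t0.
rewrite EFinM -integral_pstar_onem// /F/=.
apply: ge0_integral_scale.
- by rewrite divr_ge0 ?expR_ge0// ltW.
- by rewrite /sqd; meas.
- move=> y; rewrite mulr_ge0 ?pstar_ge0// subr_ge0 expRN_le1//.
  by rewrite mulr_ge0 ?sqd_ge0// ltW.
- move=> y; have -> : expR (- ((1 + sqd x y) * t)) =
      expR (- t) * expR (- (t * sqd x y)).
    by rewrite -expRD; congr expR; ring.
  by rewrite mul1r; ring.
Qed.

(** Frullani's kernel between [d2] and [1 + d2] factors as [(1 - e^{-t}) / t] times [e^{-t d2}]. *)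
Lemma integral_pstar_ln1DV x :
  (\int[l2]_y (pstar y * (ln (1 + sqd x y) - ln (sqd x y)))%:E =
   \int[hl]_t ((1 - expR (- t)) / t * Gstar t x)%:E)%E.
Proof.
have mp1 : measurable_fun setT (fun z : plane R * R => pstar z.1).
  exact: (measurableT_comp (@measurable_pstar R)).
have mp := @measurable_pstar R.
pose F (z : plane R * R) := (pstar z.1 *
  ((expR (- (sqd x z.1 * z.2)) - expR (- ((1 + sqd x z.1) * z.2))) / z.2))%:E.
have le1 y : sqd x y <= 1 + sqd x y by rewrite lerDr.
have F0 y t : 0 < t -> (0 <= F (y, t))%E.
  by move=> t0; rewrite lee_fin mulr_ge0 ?pstar_ge0// frullani_ge0.
have mF : measurable_fun setT F by rewrite /F /sqd; meas.
have maF : measurable_fun setT (fun z => `|F z|)%E by exact: measurableT_comp.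
(* Frullani's formula fails at [y = x], where its lower endpoint is 0, so the equality is only
   almost everywhere; the absolute value provides the measurability of the inner integral that this
   requires. *)
transitivity (\int[l2]_y \int[hl]_t (fun z => `|F z|) (y, t))%E.
  apply: ae_eq_integral.
  - by [].
  - by rewrite /sqd; meas.
  - exact: (@measurable_fun_fubini_tonelli_F _ _ _ _ _ hl (fun z => `|F z|)%E maF
      (fun z => abse_ge0 _)).
  - apply: ae_mono (ae_neq x) => y xy _.
    have a0 := sqd_gt0 xy.
    rewrite EFinM -frullani// -halflineZl ?pstar_ge0//.
    + by apply: eq_halfline => t t0; rewrite gee0_abs ?F0.
    + by meas.
    + by move=> t t0; rewrite lee_fin frullani_ge0.
rewrite (halfline_tonelli l2 (f := fun z => `|F z|)%E); last 2 first.
- exact: maF.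
- by move=> y t _; exact: abse_ge0.
apply: eq_halfline => t t0.
rewrite EFinM EFin_Gstar ?(ltW t0)//.
transitivity (\int[l2]_y (pstar y *
  ((expR (- (sqd x y * t)) - expR (- ((1 + sqd x y) * t))) / t))%:E)%E.
  by apply: eq_integral => y _; rewrite gee0_abs ?F0.
apply: ge0_integral_scale.
- by rewrite divr_ge0 ?(ltW t0)// subr_ge0 expRN_le1// ltW.
- by apply/measurable_EFinP; exact: measurable_pstar_exp.
- by move=> y; rewrite mulr_ge0 ?pstar_ge0 ?expR_ge0.
- move=> y; have -> : expR (- ((1 + sqd x y) * t)) =
      expR (- t) * expR (- (t * sqd x y)).
    by rewrite -expRD; congr expR; ring.
  by rewrite (mulrC (sqd x y)); ring.
Qed.

End potential.

(** * The potential of the profile, normalized at the origin *)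

Section newton.
Context {R : realType}.
Local Notation l2 := (@lebesgue2 R).
Local Notation hl := (@halfline R).
Local Notation "'p0'" := ((0, 0) : plane R).
Implicit Types (x y : plane R) (s t : R).

Lemma expNV_ge0 t : 0 < t -> 0 <= expR (- t) / t.
Proof. by move=> t0; rewrite divr_ge0 ?expR_ge0// ltW. Qed.

Lemma onem_expNV_ge0 t : 0 < t -> 0 <= (1 - expR (- t)) / t.
Proof.
by move=> t0; rewrite divr_ge0 ?(ltW t0)// subr_ge0 expRN_le1// ltW.
Qed.

Lemma sqrV1D_ge0 (v : R) : 0 <= (1 + v) ^- 2.
Proof. by rewrite invr_ge0 sqr_ge0. Qed.

Lemma onem_Gstar0E t : 0 < t ->
  ((1 - Gstar t p0)%:E = \int[hl]_v ((1 + v) ^- 2 * (1 - expR (- (t * v))))%:E)%E.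
Proof.
move=> t0; set I := (\int[hl]_v _)%E.
have : ((Gstar t p0)%:E + I = 1)%E.
  rewrite -integral_sqrV1D Gstar0E// -halflineD.
  - by apply: eq_halfline => v _; rewrite -EFinD; congr EFin; ring.
  - by meas.
  - by meas.
  - by move=> v _; rewrite lee_fin mulr_ge0 ?expR_ge0 ?sqrV1D_ge0.
  - move=> v v0; rewrite lee_fin mulr_ge0 ?sqrV1D_ge0// subr_ge0 expRN_le1//.
    by rewrite mulr_ge0 ?ltW.
by move=> h; rewrite EFinB -h addeAC subee// add0e.
Qed.

(** The mean of [ln (1 + |y|^2)] under the profile, by the radial form of [G(t, 0)]. That this
    integral and the companion one below have the same value makes them cancel in
    [integral_pstar_ln1D_split]. *)
Lemma integral_pstar0_ln1D :
  (\int[hl]_t (expR (- t) / t * (1 - Gstar t p0))%:E = 1)%E.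
Proof.
pose F (z : R * R) :=
  ((1 + z.2) ^- 2 * ((expR (- (1 * z.1)) - expR (- ((1 + z.2) * z.1))) / z.1))%:E.
transitivity (\int[hl]_t \int[hl]_v F (t, v))%E.
  apply: eq_halfline => t t0; rewrite EFinM onem_Gstar0E// -halflineZl.
  - apply: eq_halfline => v _; rewrite /F/= -EFinM; congr EFin.
    have -> : expR (- ((1 + v) * t)) = expR (- t) * expR (- (t * v)).
      by rewrite -expRD; congr expR; ring.
    by rewrite mul1r; ring.
  - by meas.
  - exact: expNV_ge0.
  - move=> v v0; rewrite lee_fin mulr_ge0 ?sqrV1D_ge0// subr_ge0 expRN_le1//.
    by rewrite mulr_ge0 ?ltW.
rewrite halfline_tonelli2; last 2 first.
- by rewrite /F; meas.
- move=> t v t0 v0; rewrite lee_fin mulr_ge0 ?sqrV1D_ge0// frullani_ge0//=.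
  by rewrite lerDl ltW.
rewrite -integral_sqrV1D_ln1D; apply: eq_halfline => v v0; rewrite /F/=.
have v1 : 1 <= 1 + v by rewrite lerDl ltW.
rewrite EFinM -[ln _]subr0 -ln1 -frullani// -halflineZl.
- by [].
- by meas.
- exact: sqrV1D_ge0.
- by move=> t t0; rewrite lee_fin frullani_ge0.
Qed.

Lemma integral_pstar0_ln1DV :
  (\int[hl]_t ((1 - expR (- t)) / t * Gstar t p0)%:E = 1)%E.
Proof.
pose F (z : R * R) :=
  ((1 + z.2) ^- 2 * ((expR (- (z.2 * z.1)) - expR (- ((1 + z.2) * z.1))) / z.1))%:E.
transitivity (\int[hl]_t \int[hl]_v F (t, v))%E.
  apply: eq_halfline => t t0; rewrite EFinM Gstar0E// -halflineZl.
  - apply: eq_halfline => v _; rewrite /F/= -EFinM; congr EFin.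
    have -> : expR (- ((1 + v) * t)) = expR (- t) * expR (- (t * v)).
      by rewrite -expRD; congr expR; ring.
    by rewrite (mulrC v); ring.
  - by meas.
  - exact: onem_expNV_ge0.
  - by move=> v v0; rewrite lee_fin mulr_ge0 ?expR_ge0 ?sqrV1D_ge0.
rewrite halfline_tonelli2; last 2 first.
- by rewrite /F; meas.
- move=> t v t0 v0; rewrite lee_fin mulr_ge0 ?sqrV1D_ge0// frullani_ge0//=.
  by rewrite lerDr.
rewrite -integral_sqrV1D_ln1DV; apply: eq_halfline => v v0; rewrite /F/=.
have v1 : v <= 1 + v by rewrite lerDr.
rewrite EFinM -frullani// -halflineZl.
- by [].
- by meas.
- exact: sqrV1D_ge0.
- by move=> t t0; rewrite lee_fin frullani_ge0.
Qed.

Lemma Gstar_le_origin t x : 0 < t -> Gstar t x <= Gstar t p0.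
Proof.
move=> t0; rewrite -subr_ge0 -(pmulr_lge0 _ (x := t^-1)) ?invr_gt0//.
rewrite -lee_fin Gstar_increment//; apply: halfline_ge0 => s s0.
rewrite lee_fin mulr_ge0//.
  by rewrite mulr_ge0 ?expR_ge0// divr_ge0 ?mulr_ge0 ?addr_ge0 ?ltW.
rewrite subr_ge0 expRN_le1// mulr_ge0 ?sqn_ge0//.
by rewrite divr_ge0 ?mulr_ge0 ?addr_ge0 ?ltW.
Qed.

Lemma integral_Gstar_increment x :
  (\int[hl]_t ((Gstar t p0 - Gstar t x) / t)%:E = (ln (1 + sqn x))%:E)%E.
Proof.
rewrite -integral_potential_kernel ?sqn_ge0//.
by apply: eq_halfline => t t0; rewrite Gstar_increment.
Qed.

(** [G(t, x) <= G(t, 0)] bounds it by its value at the origin. This finiteness, uniform in [x], is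
    what later permits the subtraction. *)
Lemma integral_pstar_ln1DV_le1 x :
  (\int[l2]_y (pstar y * (ln (1 + sqd x y) - ln (sqd x y)))%:E <= 1)%E.
Proof.
have m1 := @measurable_Gstar R.
rewrite integral_pstar_ln1DV -integral_pstar0_ln1DV; apply: ge0_le_halfline.
- by meas.
- by meas.
- move=> t t0; rewrite !lee_fin mulr_ge0 ?onem_expNV_ge0 ?Gstar_ge0//=.
  by rewrite ler_wpM2l ?onem_expNV_ge0 ?Gstar_le_origin.
Qed.

(** The formula for the potential with its negative part moved to the other side, so that it makes
    sense in the extended reals before any integrability is known. *)
Lemma integral_pstar_ln1D_split x :
  (\int[l2]_y (pstar y * ln (1 + sqd x y))%:E = (ln (1 + sqn x))%:E +
   \int[l2]_y (pstar y * (ln (1 + sqd x y) - ln (sqd x y)))%:E)%E.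
Proof.
have m1 := @measurable_Gstar R.
rewrite integral_pstar_ln1D integral_pstar_ln1DV -integral_Gstar_increment.
set P := (X in X = _); set C := (X in _ = (X + _)%E); set N := (X in _ = (_ + X)%E).
(* The two ones are replaced by the two integrals at the origin; the identity then holds pointwise
   in [t] between nonnegative terms. *)
suff : (P + 1 = C + N + 1)%E.
  by move=> /(congr1 (fun u => u - 1)%E); rewrite !addeK.
rewrite -[X in (P + X)%E]integral_pstar0_ln1DV -integral_pstar0_ln1D /P /C /N.
rewrite -!halflineD.
- by apply: eq_halfline => t t0; rewrite -!EFinD; congr EFin; ring.
all: try by [meas|apply: emeasurable_funD; meas].
all: move=> t t0.
- rewrite -EFinD lee_fin addr_ge0//.
    by rewrite divr_ge0 ?(ltW t0)// subr_ge0 Gstar_le_origin.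
  by rewrite mulr_ge0 ?onem_expNV_ge0 ?Gstar_ge0.
- by rewrite lee_fin mulr_ge0 ?expNV_ge0// subr_ge0 Gstar_le1// ltW.
- by rewrite lee_fin divr_ge0 ?(ltW t0)// subr_ge0 Gstar_le_origin.
- by rewrite lee_fin mulr_ge0 ?onem_expNV_ge0 ?Gstar_ge0.
- by rewrite lee_fin mulr_ge0 ?expNV_ge0// subr_ge0 Gstar_le1// ltW.
- by rewrite lee_fin mulr_ge0 ?onem_expNV_ge0 ?Gstar_ge0.
Qed.

End newton.

(** * Cross energies *)

Section cross_energy.
Context {R : realType}.
Local Notation l2 := (@lebesgue2 R).
Local Notation l4 := (@lebesgue4 R).
Implicit Types (x y : plane R).

Lemma ln1D_ge0 (a : R) : 0 <= a -> 0 <= ln (1 + a).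
Proof. by move=> a0; rewrite ln_ge0// lerDl. Qed.

Lemma ln1DV_ge0 (a : R) : 0 <= a -> 0 <= ln (1 + a) - ln a.
Proof.
(* At [a = 0] the convention [ln 0 = 0] makes the difference vanish. *)
rewrite le_eqVlt => /predU1P[<-|a0]; first by rewrite addr0 ln1 ln0// subrr.
by rewrite subr_ge0 ler_ln ?posrE ?addr_gt0// lerDr.
Qed.

Lemma measurable_ln_sqd x : measurable_fun setT (fun y => ln (sqd x y)).
Proof. by rewrite /sqd; meas. Qed.

Lemma measurable_pstar_ln x :
  measurable_fun setT (fun y => (pstar y * ln (sqd x y))%:E).
Proof.
have mp := @measurable_pstar R; have ml := measurable_ln_sqd x.
by meas.
Qed.

Let P x y := pstar y * ln (1 + sqd x y).
Let N x y := pstar y * (ln (1 + sqd x y) - ln (sqd x y)).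

Let mP x : measurable_fun setT (fun y => (P x y)%:E).
Proof. by have mp := @measurable_pstar R; rewrite /P /sqd; meas. Qed.

Let mN x : measurable_fun setT (fun y => (N x y)%:E).
Proof. by have mp := @measurable_pstar R; rewrite /N /sqd; meas. Qed.

Let P0 x y : 0 <= P x y.
Proof. by rewrite mulr_ge0 ?pstar_ge0 ?ln1D_ge0 ?sqd_ge0. Qed.

Let N0 x y : 0 <= N x y.
Proof. by rewrite mulr_ge0 ?pstar_ge0 ?ln1DV_ge0 ?sqd_ge0. Qed.

Let NE x : exists2 c : R, (\int[l2]_y (N x y)%:E = c%:E)%E & 0 <= c <= 1.
Proof.
have := integral_pstar_ln1DV_le1 x; rewrite -/(N x _) => N1.
have Nge0 : (0 <= \int[l2]_y (N x y)%:E)%E.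
  by apply: integral_ge0 => y _; rewrite lee_fin.
have Nfin : (\int[l2]_y (N x y)%:E)%E \is a fin_num.
  by rewrite ge0_fin_numE// (le_lt_trans N1) ?ltry.
exists (fine (\int[l2]_y (N x y)%:E)%E); first by rewrite fineK.
by rewrite -!lee_fin fineK// Nge0.
Qed.

Let PE x : (\int[l2]_y (P x y)%:E = (ln (1 + sqn x))%:E + \int[l2]_y (N x y)%:E)%E.
Proof. exact: integral_pstar_ln1D_split. Qed.

(** [|P - N| <= P + N], whose integral is [ln (1 + |x|^2)] plus twice that of [N], and the latter is
    at most 1. This bound reduces the integrability of cross energies to the logarithmic moment. *)
Lemma integral_pstar_abs_ln x :
  (\int[l2]_y (`|pstar y * ln (sqd x y)|)%:E <= (ln (1 + sqn x) + 2)%:E)%E.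
Proof.
have [c Nc /andP[c0 c1]] := NE x.
apply: (@le_trans _ _ (\int[l2]_y ((P x y)%:E + (N x y)%:E))%E).
  apply: ge0_le_integral.
  - by [].
  - by move=> y _; rewrite lee_fin.
  - exact: (measurableT_comp (@abse_measurable R setT) (measurable_pstar_ln x)).
  - exact: emeasurable_funD.
  - move=> y _; rewrite -EFinD lee_fin.
    have -> : pstar y * ln (sqd x y) = P x y - N x y by rewrite /P /N; ring.
    by rewrite (le_trans (ler_normB _ _))// !ger0_norm.
rewrite ge0_integralD//; last 2 first.
- by move=> y _; rewrite lee_fin.
- by move=> y _; rewrite lee_fin.
rewrite PE Nc -!EFinD lee_fin -addrA lerD2l.
by rewrite (le_trans (lerD c1 c1)).
Qed.

Lemma integrable_pstar_ln x :
  l2.-integrable setT (fun y => (pstar y * ln (sqd x y))%:E).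
Proof.
apply/integrableP; split; first exact: measurable_pstar_ln.
by rewrite (le_lt_trans (integral_pstar_abs_ln x)) ?ltry.
Qed.

Lemma integral_pstar_ln x :
  (\int[l2]_y (pstar y * ln (sqd x y))%:E = (ln (1 + sqn x))%:E)%E.
Proof.
have [c Nc _] := NE x.
have iN : l2.-integrable setT (fun y => (N x y)%:E).
  apply: (@ge0_integrable _ _ _ _ _ c); last by rewrite Nc.
    by apply/measurable_EFinP; exact: mN.
  exact: N0.
have iP : l2.-integrable setT (fun y => (P x y)%:E).
  apply: (@ge0_integrable _ _ _ _ _ (ln (1 + sqn x) + c)); last first.
  - by rewrite PE Nc EFinD.
  - exact: P0.
  - by apply/measurable_EFinP; exact: mP.
transitivity (\int[l2]_y ((P x y)%:E - (N x y)%:E))%E.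
  by apply: eq_integral => y _; rewrite -EFinB; congr EFin;
  rewrite /P /N -mulrBr; congr (_ * _); rewrite opprB addrC subrK.
by rewrite integralB// PE Nc addeK.
Qed.

(* For [f = g] this is twice [log_energy_density f]. *)
Definition bilin (f g : plane R -> R) (z : plane R * plane R) : R :=
  f z.1 * g z.2 * ln (sqd z.1 z.2).

Lemma measurable_bilin (f g : plane R -> R) : measurable_fun setT f ->
  measurable_fun setT g -> measurable_fun setT (bilin f g).
Proof.
move=> mf mg.
have mf1 : measurable_fun setT (fun z : plane R * plane R => f z.1).
  exact: (measurableT_comp mf).
have mg1 : measurable_fun setT (fun z : plane R * plane R => g z.2).
  exact: (measurableT_comp mg).
by rewrite /bilin /sqd; meas.
Qed.

Section with_pstar.
Variable f : plane R -> R.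
Hypothesis fI : l2.-integrable setT (EFin \o f).
Hypothesis flnI : l2.-integrable setT (fun x => (f x * ln (1 + sqn x))%:E).

Let mf : measurable_fun setT f.
Proof. by apply/measurable_EFinP; exact: measurable_int fI. Qed.

Let bound : (\int[l2]_x (`|f x| * (ln (1 + sqn x) + 2))%:E < +oo)%E.
Proof.
have i1 := integrable_norm flnI.
have i2 := integrableZl measurableT 2 (integrable_norm fI).
apply: integrable_lty => //.
apply: eq_integrable (integrableD measurableT i1 i2) => //= x _.
rewrite -EFinM -EFinD; congr EFin.
by rewrite normrM (ger0_norm (ln1D_ge0 (sqn_ge0 x))); ring.
Qed.

Lemma integrable_bilin_pstarr : l4.-integrable setT (EFin \o bilin f pstar).
Proof.
have mb : measurable_fun setT (EFin \o bilin f pstar).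
  by apply/measurable_EFinP; apply: measurable_bilin => //; exact: measurable_pstar.
apply: (proj2 (@integrable12ltyP _ _ _ _ R l2 l2 _ mb)).
apply: le_lt_trans bound; apply: ge0_le_integral.
- by [].
- by move=> x _; apply: integral_ge0 => y _; exact: abse_ge0.
- apply: (@measurable_fun_fubini_tonelli_F _ _ _ _ _ l2
    (fun z => `|(bilin f pstar z)%:E|)%E).
    exact: (measurableT_comp (@abse_measurable R setT) mb).
  by move=> z; exact: abse_ge0.
- apply/measurable_EFinP; apply: measurable_funM.
    exact: (measurableT_comp (@normr_measurable R setT)).
  by rewrite /sqn; meas.
- move=> x _; rewrite EFinM.
  apply: le_trans (lee_wpmul2l _ (integral_pstar_abs_ln x)); last first.
    by rewrite lee_fin.
  rewrite (@ge0_integral_scale _ _ _ _ `|f x| (fun y => `|pstar y * ln (sqd x y)|)).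
  - by [].
  - by [].
  - apply: (measurableT_comp (@normr_measurable R setT)).
    by apply/measurable_EFinP; exact: measurable_pstar_ln.
  - by [].
  - by move=> y; rewrite /bilin/= -mulrA normrM.
Qed.

Lemma integral_bilin_pstarr :
  (\int[l4]_z (bilin f pstar z)%:E = \int[l2]_x (f x * ln (1 + sqn x))%:E)%E.
Proof.
rewrite -[LHS](integral12_prod_meas1 integrable_bilin_pstarr).
apply: eq_integral => x _; rewrite /fubini_F.
transitivity (\int[l2]_y ((f x)%:E * (pstar y * ln (sqd x y))%:E))%E.
  by apply: eq_integral => y _; rewrite /bilin/= -EFinM mulrA.
by rewrite integralZl ?integral_pstar_ln//; exact: integrable_pstar_ln.
Qed.

(** As [sqd] is symmetric, integrating in the other order gives the iterated integral of
    [bilin f pstar]. *)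
Lemma integrable_bilin_pstarl : l4.-integrable setT (EFin \o bilin pstar f).
Proof.
have mb : measurable_fun setT (EFin \o bilin pstar f).
  by apply/measurable_EFinP; apply: measurable_bilin => //; exact: measurable_pstar.
apply: (proj2 (@integrable21ltyP _ _ _ _ R l2 l2 _ mb)).
have := proj1 (@integrable12ltyP _ _ _ _ R l2 l2 _
  (measurable_int _ integrable_bilin_pstarr)) integrable_bilin_pstarr.
apply: le_lt_trans; rewrite le_eqVlt; apply/orP; left; apply/eqP.
apply: eq_integral => x _; apply: eq_integral => y _.
by rewrite /bilin/= sqdC [f x * _]mulrC.
Qed.

Lemma integral_bilin_pstarl :
  (\int[l4]_z (bilin pstar f z)%:E = \int[l2]_x (f x * ln (1 + sqn x))%:E)%E.
Proof.
rewrite -[LHS](integral21_prod_meas1 integrable_bilin_pstarl).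
apply: eq_integral => x _; rewrite /fubini_G.
transitivity (\int[l2]_y ((f x)%:E * (pstar y * ln (sqd x y))%:E))%E.
  apply: eq_integral => y _; rewrite /bilin/= -EFinM sqdC; congr EFin.
  by rewrite [pstar y * _]mulrC mulrA.
by rewrite integralZl ?integral_pstar_ln//; exact: integrable_pstar_ln.
Qed.

End with_pstar.

End cross_energy.

(** * Fubini with Frullani's kernel *)

Section frullani_kernel.
Context {R : realType}.
Local Notation hl := (@halfline R).

Definition frul (a t : R) : R := (expR (- (1 * t)) - expR (- (a * t))) / t.

Lemma frul_opp (a b t : R) :
  (expR (- (a * t)) - expR (- (b * t))) / t =
  - ((expR (- (b * t)) - expR (- (a * t))) / t).
Proof. by rewrite -[RHS]mulNr opprB. Qed.

Lemma measurable_frul (a : R) : measurable_fun setT (frul a).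
Proof. by rewrite /frul; meas. Qed.

(** For [t > 0] the sign of [frul a t] is that of [a - 1], so the absolute value passes through
    Frullani's formula. By this equality, Fubini's criterion for [f * frul a] is exactly the
    integrability of [f * ln a]. *)
Lemma integral_abs_frul (a : R) : 0 < a ->
  (\int[hl]_t (`|frul a t|)%:E = (`|ln a|)%:E)%E.
Proof.
move=> a0; have [a1|/ltW a1] := leP 1 a.
  rewrite ger0_norm ?ln_ge0// -[ln a]subr0 -ln1 -frullani//.
  by apply: eq_halfline => t t0; rewrite ger0_norm// frullani_ge0.
rewrite ler0_norm ?ln_le0// -[X in (X)%:E]add0r -ln1 -frullani//.
apply: eq_halfline => t t0; rewrite /frul frul_opp normrN.
by rewrite ger0_norm// frullani_ge0.
Qed.

Lemma integrable_frul (a : R) : 0 < a -> hl.-integrable setT (EFin \o frul a).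
Proof.
move=> a0; apply/integrableP; split.
  by apply/measurable_EFinP; exact: measurable_frul.
rewrite (_ : integral _ _ _ = \int[hl]_t (`|frul a t|)%:E)%E; last exact: eq_integral.
by rewrite integral_abs_frul// ltry.
Qed.

Lemma integral_frul (a : R) : 0 < a -> (\int[hl]_t (frul a t)%:E = (ln a)%:E)%E.
Proof.
move=> a0; have [a1|/ltW a1] := leP 1 a.
  by rewrite -[ln a]subr0 -ln1 -frullani.
have ig : hl.-integrable setT
    (fun t => ((expR (- (a * t)) - expR (- (1 * t))) / t)%:E).
  apply: eq_integrable (integrableN (integrable_frul a0)) => // t _.
  by rewrite /= /frul -frul_opp.
transitivity (\int[hl]_t ((-1)%:E *
    ((expR (- (a * t)) - expR (- (1 * t))) / t)%:E))%E.
  by apply: eq_integral => t _; rewrite /frul frul_opp -EFinM mulN1r.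
by rewrite integralZl// frullani// ln1 sub0r -EFinM mulN1r opprK.
Qed.

Section fubini.
Context d (T : measurableType d).
Variable m : {sigma_finite_measure set T -> \bar R}.
Variables f a : T -> R.
Hypotheses (mf : measurable_fun setT f) (ma : measurable_fun setT a).
Hypothesis a_gt0 : {ae m, forall z, 0 < a z}.
Hypothesis flnI : m.-integrable setT (fun z => (f z * ln (a z))%:E).

Let F (u : T * R) : \bar R := (f u.1 * frul (a u.1) u.2)%:E.

Let mF : measurable_fun setT F.
Proof.
have mf1 : measurable_fun setT (fun u : T * R => f u.1).
  exact: (measurableT_comp mf).
have ma1 : measurable_fun setT (fun u : T * R => a u.1).
  exact: (measurableT_comp ma).
by rewrite /F /frul; meas.
Qed.

Let mabsF : measurable_fun setT (fun u => `|F u|)%E.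
Proof. exact: (measurableT_comp (@abse_measurable R setT) mF). Qed.

Let mfln : measurable_fun setT (fun z => (f z * ln (a z))%:E).
Proof. by meas. Qed.

Let FI : (m \x hl)%E.-integrable setT F.
Proof.
apply: (proj2 (@integrable12ltyP _ _ _ _ R m hl F mF)).
have /integrableP[_] := flnI; apply: le_lt_trans.
rewrite le_eqVlt; apply/orP; left; apply/eqP.
apply: ae_eq_integral.
- by [].
- exact: (@measurable_fun_fubini_tonelli_F _ _ _ _ _ hl _ mabsF (fun=> abse_ge0 _)).
- exact: (measurableT_comp (@abse_measurable R setT) mfln).
- apply: ae_mono a_gt0 => z az _.
  rewrite /= normrM EFinM -integral_abs_frul//.
  apply: ge0_integral_scale.
  + by [].
  + apply: (measurableT_comp (@normr_measurable R setT)).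
    exact: measurable_frul.
  + by [].
  + by move=> t; rewrite normrM.
Qed.

(** Meant for pairs of points, with [a] the squared distance, which is positive off the diagonal,
    and [f] the product of two values of the deviation. *)
Lemma frullani_fubini :
  (\int[m]_z (f z * ln (a z))%:E =
   \int[hl]_t \int[m]_z (f z * frul (a z) t)%:E)%E.
Proof.
rewrite -(Fubini FI); apply: ae_eq_integral.
- by [].
- exact: mfln.
- exact: (measurable_fubini_F FI).
- apply: ae_mono a_gt0 => z az _; rewrite /F/=.
  transitivity (\int[hl]_t ((f z)%:E * (frul (a z) t)%:E))%E; last first.
    by apply: eq_integral => t _; rewrite -EFinM.
  by rewrite integralZl ?integral_frul//; exact: integrable_frul.
Qed.

Lemma measurable_frullani_fubini :
  measurable_fun setT (fun t => \int[m]_z (f z * frul (a z) t)%:E)%E.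
Proof. exact: (measurable_fubini_G FI). Qed.

End fubini.

End frullani_kernel.

(** * The energy of a neutral density as a sum of squares *)

Section gauss_transform.
Context {R : realType}.
Local Notation l2 := (@lebesgue2 R).
Local Notation l4 := (@lebesgue4 R).
Implicit Types (x y w : plane R) (t : R).

Variable sigma : plane R -> R.
Hypothesis sigmaI : l2.-integrable setT (EFin \o sigma).

Let msigma : measurable_fun setT sigma.
Proof. by apply/measurable_EFinP; exact: measurable_int sigmaI. Qed.

Let msigma1 : measurable_fun setT (fun z : plane R * plane R => sigma z.1).
Proof. exact: (measurableT_comp msigma). Qed.

Let B : R := \int[l2]_y `|sigma y|.

Let BE : (\int[l2]_y (`|sigma y|)%:E = B%:E)%E.
Proof.
rewrite /B /Rintegral fineK//; apply: integrable_fin_num => //.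
exact: (integrable_norm sigmaI).
Qed.

(** The inner integral of [|F|] is at most [D |sigma x|], which is integrable. It serves both
    Gaussian kernels and the kernel [|sigma y| / t]. *)
Lemma integrable_dominated_kernel (F : plane R * plane R -> R)
    (g : plane R -> plane R -> R) (D : R) :
  measurable_fun setT F -> (forall x, measurable_fun setT (g x)) ->
  (forall x y, 0 <= g x y) -> (forall x y, `|F (x, y)| <= `|sigma x| * g x y) ->
  (forall x, \int[l2]_y (g x y)%:E <= D%:E)%E ->
  l4.-integrable setT (EFin \o F).
Proof.
move=> mF mg g0 Fg gD.
have mEF : measurable_fun setT (EFin \o F) by apply/measurable_EFinP.
have maF : measurable_fun setT (fun z => `|(F z)%:E|)%E.
  exact: (measurableT_comp (@abse_measurable R setT) mEF).
have mabs : measurable_fun setT (fun x => `|sigma x|).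
  exact: (measurableT_comp (@normr_measurable R setT) msigma).
apply: (proj2 (@integrable12ltyP _ _ _ _ R l2 l2 _ mEF)).
apply: (@le_lt_trans _ _ (\int[l2]_x (`|sigma x| * D)%:E)%E); last first.
  apply: integrable_lty => //.
  exact: (integrableZr measurableT D (integrable_norm sigmaI)).
apply: ge0_le_integral.
- by [].
- by move=> x _; apply: integral_ge0 => y _; exact: abse_ge0.
- exact: (@measurable_fun_fubini_tonelli_F _ _ _ _ _ l2 _ maF (fun=> abse_ge0 _)).
- by meas.
- move=> x _.
  apply: (@le_trans _ _ (\int[l2]_y (`|sigma x| * g x y)%:E)%E).
    apply: ge0_le_integral.
    + by [].
    + by move=> y _; exact: abse_ge0.
    + exact: (measurableT_comp maF (pair1_measurable x)).
    + by have mgx := mg x; meas.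
    + by move=> y _; rewrite lee_fin Fg.
  rewrite EFinM; apply: le_trans (lee_wpmul2l _ (gD x)); last by rewrite lee_fin.
  by rewrite (@ge0_integral_scale _ _ _ _ `|sigma x| (g x)).
Qed.

(** The [S(t, w)] of the overview; up to a factor, [sigma] after heat flow for the time
    [1 / (4 t)]. *)
Definition gtrans t w : R := \int[l2]_y (sigma y * expR (- (t * sqd y w))).

Lemma integrable_gtrans t w : 0 <= t ->
  l2.-integrable setT (fun y => (sigma y * expR (- (t * sqd y w)))%:E).
Proof.
move=> t0; apply: (le_integrable _ _ _ sigmaI) => //.
- by rewrite /sqd; meas.
- move=> y _; rewrite !abse_EFin lee_fin normrM ler_piMr//.
  by rewrite ger0_norm ?expR_ge0// expRN_le1// mulr_ge0 ?sqd_ge0.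
Qed.

Lemma EFin_gtrans t w : 0 <= t ->
  ((gtrans t w)%:E = \int[l2]_y (sigma y * expR (- (t * sqd y w)))%:E)%E.
Proof.
move=> t0; rewrite /gtrans /Rintegral fineK//.
by apply: integrable_fin_num => //; exact: integrable_gtrans.
Qed.

Lemma gtrans_bound t w : 0 <= t -> `|gtrans t w| <= B.
Proof.
move=> t0; rewrite -lee_fin -abse_EFin EFin_gtrans// -BE.
have iw := integrable_gtrans w t0.
apply: le_trans (le_abse_integral _ _ _) _ => //.
  exact: measurable_int iw.
apply: ge0_le_integral.
- by [].
- by move=> y _; exact: abse_ge0.
- apply: (measurableT_comp (@abse_measurable R setT)).
  exact: measurable_int iw.
- apply/measurable_EFinP.
  exact: (measurableT_comp (@normr_measurable R setT) msigma).
- move=> y _; rewrite abse_EFin lee_fin normrM ler_piMr//.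
  by rewrite ger0_norm ?expR_ge0// expRN_le1// mulr_ge0 ?sqd_ge0.
Qed.

Section swap.
Variables (t C : R) (h c : plane R -> R).
Hypotheses (t_gt0 : 0 < t) (mh : measurable_fun setT h).
Hypothesis hC : forall w, `|h w| <= C.

Let F (z : plane R * plane R) : R :=
  sigma z.1 * (expR (- (t * sqd z.1 z.2)) * h z.2).

Let FI : l4.-integrable setT (EFin \o F).
Proof.
have C0 : 0 <= C by apply: le_trans (hC (0, 0)).
have mh2 : measurable_fun setT (fun z : plane R * plane R => h z.2).
  exact: (measurableT_comp mh).
apply: (@integrable_dominated_kernel F
  (fun y w => C * expR (- (t * sqd w y))) (C * (pi / t))).
- by rewrite /F /sqd; meas.
- by move=> x; rewrite /sqd; meas.
- by move=> x y; rewrite mulr_ge0 ?expR_ge0.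
- move=> x y; rewrite /F/= normrM ler_wpM2l// normrM ger0_norm ?expR_ge0//.
  by rewrite sqdC mulrC ler_wpM2r ?expR_ge0.
- move=> x; rewrite (@ge0_integral_scale _ _ _ _ C (fun y => expR (- (t * sqd y x)))).
  + by rewrite integral_gauss// -EFinM.
  + exact: C0.
  + by rewrite /sqd; meas.
  + by move=> y; exact: expR_ge0.
  + by [].
Qed.

(** Self-adjointness of Gaussian convolution, where [c] is the transform of the bounded function
    [h]. It is applied with [h] a Gaussian, a transform of [sigma], and a multiple of the indicator
    of a quadrant. *)
Lemma gtrans_swap :
  (forall y, (\int[l2]_w (expR (- (t * sqd y w)) * h w)%:E = (c y)%:E)%E) ->
  (\int[l2]_y (sigma y * c y)%:E = \int[l2]_w (gtrans t w * h w)%:E)%E.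
Proof.
move=> hc; have := @Fubini _ _ _ _ R l2 l2 _ FI.
have -> : (\int[l2]_y \int[l2]_w (EFin \o F) (y, w) =
    \int[l2]_y (sigma y * c y)%:E)%E.
  apply: eq_integral => y _; rewrite EFinM -hc.
  transitivity (\int[l2]_w ((sigma y)%:E * (expR (- (t * sqd y w)) * h w)%:E))%E.
    by apply: eq_integral => w _; rewrite -EFinM.
  apply: integralZl => //.
  have C0 : 0 <= C by apply: le_trans (hC (0, 0)).
  apply: (@le_integrable _ _ _ _ _ measurableT _
    (fun w => (C * expR (- (t * sqd w y)))%:E)).
  - by rewrite /sqd; meas.
  - move=> w _; rewrite !abse_EFin lee_fin normrM ger0_norm ?expR_ge0//.
    rewrite [leRHS]ger0_norm ?mulr_ge0 ?expR_ge0// sqdC mulrC.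
    by rewrite ler_wpM2r ?expR_ge0.
  - apply: (@ge0_integrable _ _ _ _ _ (C * (pi / t))).
    + by rewrite /sqd; meas.
    + by move=> w; rewrite mulr_ge0 ?expR_ge0.
    + rewrite (@ge0_integral_scale _ _ _ _ C (fun w => expR (- (t * sqd w y)))).
      * by rewrite integral_gauss// -EFinM.
      * exact: C0.
      * by rewrite /sqd; meas.
      * by move=> w; exact: expR_ge0.
      * by [].
move=> ->; apply: eq_integral => w _; rewrite EFinM EFin_gtrans ?(ltW t_gt0)//.
rewrite -integralZr//; last by apply: integrable_gtrans; exact: ltW.
by apply: eq_integral => y _; rewrite /F/= -EFinM mulrA.
Qed.

Lemma measurable_gtransM :
  measurable_fun setT (fun w => (gtrans t w * h w)%:E).
Proof.
have := measurable_fubini_G FI; congr measurable_fun; apply/funext => w.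
rewrite /fubini_G EFinM EFin_gtrans ?(ltW t_gt0)// -integralZr//.
  by apply: eq_integral => y _; rewrite /F/= -EFinM mulrA.
by apply: integrable_gtrans; exact: ltW.
Qed.

End swap.

Lemma measurable_gtrans t : 0 < t -> measurable_fun setT (gtrans t).
Proof.
move=> t0; apply/measurable_EFinP.
have := @measurable_gtransM t 1 (cst 1) t0 (measurable_cst _) _.
rewrite (_ : (fun w => _) = EFin \o gtrans t); last first.
  by apply/funext => w; rewrite mulr1.
by apply => w; rewrite normr1.
Qed.

(** Two Gaussians of parameter [2 t] convolve to one of parameter [(2 t)^2 / (4 t) = t], with factor
    [pi / (4 t)]. This is the origin of the argument [2 t] and of the constant [4 / pi] below. *)
Lemma gtrans_double t y : 0 < t ->
  (\int[l2]_w (expR (- (2 * t * sqd y w)) * gtrans (2 * t) w)%:E =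
   (pi / (4 * t) * gtrans t y)%:E)%E.
Proof.
move=> t0; have t20 : 0 < 2 * t by rewrite mulr_gt0.
transitivity (\int[l2]_w (gtrans (2 * t) w * expR (- (2 * t * sqd w y)))%:E)%E.
  by apply: eq_integral => w _; rewrite mulrC sqdC.
rewrite -(@gtrans_swap (2 * t) 1 (fun w => expR (- (2 * t * sqd w y)))
   (fun x => pi / (4 * t) * expR (- (t * sqd x y)))).
- rewrite EFinM EFin_gtrans ?(ltW t0)// -integralZl//.
    by apply: eq_integral => x _; rewrite -EFinM mulrCA.
  by apply: integrable_gtrans; exact: ltW.
- by [].
- by rewrite /sqd; meas.
- move=> w; rewrite ger0_norm ?expR_ge0// expRN_le1// mulr_ge0 ?sqd_ge0//.
  exact: ltW.
- move=> x; rewrite -[LHS]/(\int[l2]_w _)%E.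
  transitivity (\int[l2]_w (expR (- (2 * t * sqd w y)) *
      expR (- (2 * t * sqd x w)))%:E)%E.
    by apply: eq_integral => w _; rewrite mulrC.
  rewrite integral_gaussM//; congr EFin.
  have -> : 2 * t * (2 * t) / (2 * t + 2 * t) = t by field; rewrite gt_eqF// addr_gt0.
  have -> : 2 * t + 2 * t = 4 * t by ring.
  by rewrite (mulrC (sqd _ _)).
Qed.

(** Self-adjointness with [h] the transform at [2 t] itself, which is bounded by the [L^1] norm [B],
    produces the square. *)
Lemma integral_gtrans t : 0 < t ->
  (\int[l2]_y (sigma y * (pi / (4 * t) * gtrans t y))%:E =
   \int[l2]_w (gtrans (2 * t) w ^+ 2)%:E)%E.
Proof.
move=> t0; have t20 : 0 < 2 * t by rewrite mulr_gt0.
rewrite (@gtrans_swap (2 * t) B (gtrans (2 * t))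
   (fun y => pi / (4 * t) * gtrans t y)).
- by [].
- by [].
- exact: measurable_gtrans.
- by move=> w; apply: gtrans_bound; exact: ltW.
- by move=> y; exact: gtrans_double.
Qed.

Lemma frul_bound (a t : R) : 0 <= a -> 0 < t -> `|frul a t| <= t^-1.
Proof.
move=> a0 t0; rewrite /frul normrM [X in _ * X]ger0_norm ?invr_ge0 ?(ltW t0)//.
rewrite ler_piMl ?invr_ge0 ?(ltW t0)//.
have e1 : 0 <= expR (- (1 * t)) <= 1.
  by rewrite expR_ge0 expRN_le1// mul1r ltW.
have e2 : 0 <= expR (- (a * t)) <= 1.
  by rewrite expR_ge0 expRN_le1// mulr_ge0// ltW.
by rewrite ler_norml; lra.
Qed.

(** In [y], [frul] is a constant minus a Gaussian over [t]; neutrality annihilates the constant. *)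
Lemma integral_sigma_frul t x : 0 < t -> (\int[l2]_y (sigma y)%:E = 0)%E ->
  (\int[l2]_y (sigma y * frul (sqd x y) t)%:E = (- (gtrans t x / t))%:E)%E.
Proof.
move=> t0 sigma0.
transitivity (\int[l2]_y ((expR (- (1 * t)) / t)%:E * (sigma y)%:E -
    (t^-1)%:E * (sigma y * expR (- (t * sqd y x)))%:E))%E.
  apply: eq_integral => y _; rewrite /frul -!EFinM -EFinB; congr EFin.
  by rewrite sqdC (mulrC (sqd _ _)); ring.
rewrite integralB//.
- rewrite integralZl// sigma0 mule0 sub0e integralZl//.
    by rewrite -EFin_gtrans ?(ltW t0)// -EFinM -EFinN mulrC.
  by apply: integrable_gtrans; exact: ltW.
- exact: integrableZl.
- by apply: integrableZl => //; apply: integrable_gtrans; exact: ltW.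
Qed.

(** After the inner integration, [- 1 / t] is written as [- (4 / pi)] times the factor [pi / (4 t)]
    of [integral_gtrans], so the remaining constant does not depend on [t]. *)
Lemma integral_sigma2_frul t : 0 < t -> (\int[l2]_y (sigma y)%:E = 0)%E ->
  (\int[l4]_z (sigma z.1 * sigma z.2 * frul (sqd z.1 z.2) t)%:E =
   (- (4 / pi))%:E * \int[l2]_w (gtrans (2 * t) w ^+ 2)%:E)%E.
Proof.
move=> t0 sigma0.
pose F (z : plane R * plane R) := sigma z.1 * sigma z.2 * frul (sqd z.1 z.2) t.
have FI : l4.-integrable setT (EFin \o F).
  have msigma2 : measurable_fun setT (fun z : plane R * plane R => sigma z.2).
    exact: (measurableT_comp msigma).
  have mabs : measurable_fun setT (fun x => `|sigma x|).
    exact: (measurableT_comp (@normr_measurable R setT) msigma).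
  apply: (@integrable_dominated_kernel F (fun x y => t^-1 * `|sigma y|) (t^-1 * B)).
  - by rewrite /F /frul /sqd; meas.
  - by move=> x; meas.
  - by move=> x y; rewrite mulr_ge0// invr_ge0 ltW.
  - move=> x y; rewrite /F/= 2!normrM -mulrA ler_wpM2l// mulrC ler_wpM2r//.
    by rewrite frul_bound ?sqd_ge0.
  - move=> x; rewrite EFinM -BE.
    rewrite (@ge0_integral_scale _ _ _ _ (t^-1) (fun y => `|sigma y|))//.
    by rewrite invr_ge0 ltW.
rewrite -[LHS](integral12_prod_meas1 FI) -integral_gtrans// -integralZl//.
- apply: eq_integral => x _; rewrite /fubini_F /F/= -EFinM.
  transitivity (\int[l2]_y ((sigma x)%:E * (sigma y * frul (sqd x y) t)%:E))%E.
    by apply: eq_integral => y _; rewrite -EFinM -mulrA.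
  rewrite integralZl//.
    rewrite integral_sigma_frul// -EFinM; congr EFin.
    by move: (@pi R) (pi_gt0 R) => p p0; field; rewrite !gt_eqF.
  apply: (@le_integrable _ _ _ _ _ measurableT _ (fun y => (t^-1)%:E * (sigma y)%:E)%E).
  - by rewrite /frul /sqd; meas.
  - move=> y _; rewrite -EFinM !abse_EFin lee_fin 2!normrM mulrC ler_wpM2r//.
    rewrite [leRHS]ger0_norm ?invr_ge0 ?(ltW t0)//.
    by rewrite frul_bound ?sqd_ge0.
  - exact: integrableZl.
- apply: (@le_integrable _ _ _ _ _ measurableT _
    (fun y => (pi / (4 * t) * B)%:E * (sigma y)%:E)%E).
  - by have mg := measurable_gtrans t0; meas.
  - move=> y _; rewrite -EFinM !abse_EFin lee_fin [leLHS]normrM [leRHS]normrM.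
    rewrite mulrC ler_wpM2r//.
    rewrite [leLHS]normrM [leRHS]normrM.
    rewrite ler_wpM2l// (le_trans (gtrans_bound y (ltW t0)))//.
    exact: ler_norm.
  - exact: integrableZl.
Qed.

End gauss_transform.

(** * Densities with vanishing Gaussian transforms *)

Section quadrants.
Context {R : realType}.
Local Notation mu := (@lebesgue_measure R).
Local Notation l2 := (@lebesgue2 R).

(** [None] is the whole line: half-planes and the plane itself then count as quadrants, which
    therefore contain the generators for each coordinate. *)
Definition ray (a : option R) : set (measurableTypeR R) :=
  if a is Some r then `]r, +oo[%classic else setT.

Lemma measurable_ray a : measurable (ray a).
Proof. by case: a => [r|]; [exact: measurable_itv|exact: measurableT]. Qed.

Lemma ray_setI a b : exists c, ray a `&` ray b = ray c.
Proof.
case: a => [a|]; last by exists b; rewrite setTI.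
case: b => [b|]; last by exists (Some a); rewrite setIT.
exists (Some (Num.max a b)); apply/seteqP; split => r /=.
  by rewrite !in_itv/= !andbT gt_max => -[-> ->].
by rewrite !in_itv/= !andbT gt_max => /andP[].
Qed.

Definition quadrant (ab : option R * option R) : set (plane R) :=
  ray ab.1 `*` ray ab.2.

Lemma measurable_quadrant ab : measurable (quadrant ab).
Proof. by apply: measurableX; exact: measurable_ray. Qed.

Lemma quadrant_setI_closed : setI_closed (range quadrant).
Proof.
move=> _ _ [[a b] _ <-] [[c d] _ <-].
have [e ace] := ray_setI a c; have [f bdf] := ray_setI b d.
exists (e, f) => //; rewrite /quadrant/= -ace -bdf.
by apply/seteqP; split => [z [] [? ?] [? ?]|z [] [? ?] [? ?]].
Qed.

Lemma sub_preimage_sigma (T : Type) (G : set (set T)) (f : T -> measurableTypeR R) :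
  (forall r, <<s G >> (f @^-1` `]r, +oo[%classic)) ->
  forall A, measurable A -> <<s G >> (f @^-1` A).
Proof.
move=> Gr A; have -> : @measurable _ (measurableTypeR R) = <<s @RGenOInfty.G R >>.
  exact: RGenOInfty.measurableE.
suff : <<s @RGenOInfty.G R >> `<=` [set B | <<s G >> (f @^-1` B)] by exact.
apply: smallest_sub; last by move=> _ [r ->]; exact: Gr.
split.
- by rewrite /= preimage_set0; exact: sigma_algebra0.
- by move=> B GB; rewrite /= setTD preimage_setC -setTD; exact: sigma_algebraCD.
- by move=> F GF; rewrite /= preimage_bigcup; exact: sigma_algebra_bigcup.
Qed.

Lemma measurable_planeE : @measurable _ (plane R) = <<s range quadrant >>.
Proof.
apply/seteqP; split; last first.
  apply: smallest_sub; first exact: sigma_algebra_measurable.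
  by move=> _ [ab _ <-]; exact: measurable_quadrant.
apply: smallest_sub; first exact: smallest_sigma_algebra.
move=> _ [|] [A mA <-]; rewrite setTI.
- apply: sub_preimage_sigma mA => r; apply: sub_sigma_algebra.
  exists (Some r, None) => //.
  by apply/seteqP; split => [z []//|z ?]; split.
- apply: sub_preimage_sigma mA => r; apply: sub_sigma_algebra.
  exists (None, Some r) => //.
  by apply/seteqP; split => [z []//|z ?]; split.
Qed.

(** The sets over which [f] has integral 0 are stable under complement and countable disjoint union,
    and the quadrants form a pi-system; Dynkin's theorem extends the vanishing to all measurable
    sets. The quadrant [(None, None)] gives the whole plane, needed for complements. *)
Lemma quadrant_ae_eq0 (f : plane R -> R) : l2.-integrable setT (EFin \o f) ->
  (forall ab, \int[l2]_(x in quadrant ab) (f x)%:E = 0)%E ->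
  {ae l2, forall x, f x = 0}.
Proof.
move=> fI f0.
have fS A : measurable A -> l2.-integrable A (EFin \o f).
  by move=> mA; apply: integrableS fI.
have fA A : measurable A -> (\int[l2]_(x in A) (f x)%:E = 0)%E.
  rewrite {1}measurable_planeE.
  apply: (dynkin_induction (P := fun A => (\int[l2]_(x in A) (f x)%:E = 0)%E)).
  - exact: measurable_planeE.
  - exact: quadrant_setI_closed.
  - rewrite -(f0 (None, None)); congr (integral _ _ _).
    by apply/seteqP; split => // x _; split.
  - by move=> _ [ab _ <-]; exact: f0.
  - move=> S mS fS0.
    have := @integral_setU _ _ _ l2 S (~` S) (EFin \o f) mS (measurableC mS).
    rewrite setUCr => /(_ (measurable_int _ fI)).
    have -> : (\int[l2]_x (EFin \o f) x = 0)%E.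
      rewrite -(f0 (None, None)); congr (integral _ _ _).
      by apply/seteqP; split => // x _; split.
    rewrite fS0 add0e => -> //.
    by apply/disj_set2P; rewrite setICr.
  - move=> F mF tF F0; rewrite integral_bigcup//.
      by rewrite eseries0.
    by apply: fS; exact: bigcupT_measurable.
have : ae_eq l2 setT (EFin \o f) (cst 0%E).
  apply: integral_ae_eq => //.
  by move=> E _ mE; rewrite integral0; exact: fA.
by apply: ae_mono => x /(_ I) [].
Qed.

End quadrants.

(** * Gaussian approximation of indicators *)

Section gauss_approximation.
Context {R : realType}.
Local Notation mu := (@lebesgue_measure R).
Local Notation l2 := (@lebesgue2 R).
Implicit Types (x y w : plane R) (t : R) (A : set (plane R)).

(** The total mass of the Gaussian is [pi / t], so [t / pi * smear t A y] is an average of the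
    indicator of [A] around [y]. *)
Definition smear t A y : R := \int[l2]_w (expR (- (t * sqd y w)) * \1_A w).

Let mE t A y : measurable A ->
  measurable_fun setT (fun w => expR (- (t * sqd y w)) * \1_A w).
Proof.
move=> mA; have m1 : measurable_fun setT (\1_A : plane R -> R).
  exact: measurable_indic.
by rewrite /sqd; meas.
Qed.

Let E0 t A y w : 0 <= expR (- (t * sqd y w)) * \1_A w.
Proof. by rewrite mulr_ge0 ?expR_ge0. Qed.

Let Ele t A y : measurable A -> 0 < t ->
  (\int[l2]_w (expR (- (t * sqd y w)) * \1_A w)%:E <= (pi / t)%:E)%E.
Proof.
move=> mA t0; rewrite -(integral_gauss y t0); apply: ge0_le_integral.
- by [].
- by move=> w _; rewrite lee_fin.
- by apply/measurable_EFinP; exact: mE.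
- by rewrite /sqd; meas.
- by move=> w _; rewrite lee_fin sqdC ler_piMr ?expR_ge0// indicE; case: (_ \in _).
Qed.

Lemma EFin_smear t A y : measurable A -> 0 < t ->
  ((smear t A y)%:E = \int[l2]_w (expR (- (t * sqd y w)) * \1_A w)%:E)%E.
Proof.
move=> mA t0; rewrite /smear /Rintegral fineK// ge0_fin_numE.
  by rewrite (le_lt_trans (Ele y mA t0)) ?ltry.
by apply: integral_ge0 => w _; rewrite lee_fin.
Qed.

Lemma smear_ge0 t A y : 0 <= smear t A y.
Proof. by apply: Rintegral_ge0 => w _. Qed.

Lemma smear_le t A y : measurable A -> 0 < t -> smear t A y <= pi / t.
Proof. by move=> mA t0; rewrite -lee_fin EFin_smear// Ele. Qed.

Lemma smearC t A y : measurable A -> 0 < t ->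
  smear t A y + smear t (~` A) y = pi / t.
Proof.
move=> mA t0; have mA' := measurableC mA.
have : ((smear t A y)%:E + (smear t (~` A) y)%:E = (pi / t)%:E)%E.
  rewrite !EFin_smear// -(integral_gauss y t0) -ge0_integralD.
  - apply: eq_integral => w _; rewrite -EFinD -mulrDr sqdC !indicE in_setC.
    by case: (_ \in _); rewrite ?addr0 ?add0r mulr1.
  - by [].
  - by move=> w _; rewrite lee_fin.
  - by apply/measurable_EFinP; exact: mE.
  - by move=> w _; rewrite lee_fin.
  - by apply/measurable_EFinP; exact: mE.
by rewrite -EFinD => -[].
Qed.

(** Half of the exponent pays for the distance, and the other half keeps a Gaussian to integrate. *)
Lemma smear_far t A y (e : R) : measurable A -> 0 < t ->
  (forall w, A w -> e <= sqd y w) ->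
  smear t A y <= expR (- (t / 2 * e)) * (pi / (t / 2)).
Proof.
move=> mA t0 Ae; have t20 : 0 < t / 2 by rewrite divr_gt0.
rewrite -lee_fin EFin_smear// EFinM -(integral_gauss y t20).
rewrite -(@ge0_integral_scale _ _ _ _ (expR (- (t / 2 * e)))
  (fun w => expR (- (t / 2 * sqd w y)))
  (fun w => expR (- (t / 2 * e)) * expR (- (t / 2 * sqd w y)))).
- apply: ge0_le_integral.
  + by [].
  + by move=> w _; rewrite lee_fin.
  + by apply/measurable_EFinP; exact: mE.
  + by rewrite /sqd; meas.
  + move=> w _; rewrite lee_fin indicE; have [|_] := boolP (w \in A).
      rewrite inE mulr1 -expRD => /Ae ew.
      rewrite ler_expR (sqdC w); move: (sqd y w) ew => s es.
      by have := ler_wpM2l (ltW t20) es; lra.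
    by rewrite mulr0 mulr_ge0 ?expR_ge0.
- exact: expR_ge0.
- by rewrite /sqd; meas.
- by move=> w; exact: expR_ge0.
- by [].
Qed.

Lemma smear_approx t A y (e : R) : measurable A -> 0 < t ->
  (forall w, sqd y w < e -> (A w <-> A y)) ->
  `|t / pi * smear t A y - \1_A y| <= 2 * expR (- (t / 2 * e)).
Proof.
move=> mA t0 Ae.
have tpi : 0 <= t / pi by rewrite divr_ge0 ?pi_ge0 ?ltW.
have key B : measurable B -> (forall w, B w -> e <= sqd y w) ->
    t / pi * smear t B y <= 2 * expR (- (t / 2 * e)).
  move=> mB Be; have := ler_wpM2l tpi (smear_far mB t0 Be).
  move=> /le_trans; apply; rewrite le_eqVlt; apply/orP; left; apply/eqP.
  by move: (@pi R) (pi_gt0 R) => p p0; field; rewrite !gt_eqF.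
have s0 B : 0 <= t / pi * smear t B y by rewrite mulr_ge0 ?smear_ge0.
have [yA|nyA] := pselect (A y).
  rewrite indicE mem_set//=.
  have -> : t / pi * smear t A y - 1 = - (t / pi * smear t (~` A) y).
    have := smearC y mA t0 => /(congr1 (fun u => t / pi * u)).
    rewrite mulrDr => /(canRL (addrK _)) ->.
    have -> : t / pi * (pi / t) = 1.
      by move: (@pi R) (pi_gt0 R) => p p0; field; rewrite !gt_eqF.
    by rewrite addrAC subrr add0r.
  rewrite normrN ger0_norm//; apply: key; first exact: measurableC.
  by move=> w /= nAw; rewrite leNgt; apply/negP => /Ae[_ /(_ yA)].
rewrite indicE memNset//= subr0 ger0_norm//; apply: key => // w Aw.
by rewrite leNgt; apply/negP => /Ae[/(_ Aw)].
Qed.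

Lemma smear_cvg (u : R^nat) A y (e : R) : measurable A -> 0 < e ->
  (forall n, n.+1%:R <= u n) -> (forall w, sqd y w < e -> (A w <-> A y)) ->
  u n / pi * smear (u n) A y @[n --> \oo] --> (\1_A y : R).
Proof.
move=> mA e0 un Ae; apply/subr_cvg0; apply/norm_cvg0P.
(* With [x = u n * e / 2], [2 e^{-x} <= 2 / x = 4 / (e * u n)], and [u n >= n + 1]. *)
apply: (@squeeze_cvgr _ _ _ _ (cst 0) (fun n => 4 / e * harmonic n)).
- apply: nearW => n; rewrite normr_ge0/=.
  have un0 : 0 < u n by apply: lt_le_trans (un n).
  apply: le_trans (smear_approx mA un0 Ae) _.
  have x0 : 0 < u n / 2 * e by rewrite mulr_gt0// divr_gt0.
  have ex : expR (- (u n / 2 * e)) <= (u n / 2 * e)^-1.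
    rewrite expRN lef_pV2 ?posrE ?expR_gt0//.
    by rewrite (le_trans _ (expR_ge1Dx _))// lerDr.
  apply: le_trans (ler_wpM2l _ ex) _ => //.
  rewrite [leLHS](_ : _ = 4 / e * (u n)^-1); last by field; rewrite !gt_eqF.
  rewrite ler_wpM2l ?divr_ge0 ?(ltW e0)// lef_pV2 ?posrE//.
- exact: cvg_cst.
- rewrite -[X in _ --> X](mulr0 (4 / e)); apply: cvgMr.
  exact: cvg_harmonic.
Qed.

Lemma ray_locally_constant (a : option R) (r : R) : a <> Some r ->
  exists2 e : R, 0 < e & forall s, (r - s) ^+ 2 < e -> (ray a s <-> ray a r).
Proof.
case: a => [a ar|_]; last by exists 1.
have ra : r - a != 0 by rewrite subr_eq0; apply: contra_notN ar => /eqP ->.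
exists ((r - a) ^+ 2); first by rewrite exprn_even_gt0.
move=> s rs; rewrite /ray/= !in_itv/= !andbT.
(* The factored form of [|r - s| < |r - a|]: [s] lies strictly between [a] and its mirror image
   [2 r - a]. *)
have rs' : (s - a) * (s + a - 2 * r) < 0.
  suff -> : (s - a) * (s + a - 2 * r) = (r - s) ^+ 2 - (r - a) ^+ 2.
    by rewrite subr_lt0.
  by ring.
by clear ar; split => h; rewrite ltNge; apply/negP => h'; nra.
Qed.

(** Exceptional points lie on the lines carrying the edges, at most two, which are null sets. *)
Lemma quadrant_locally_constant ab : {ae l2, forall y, exists2 e : R, 0 < e &
  forall w, sqd y w < e -> (quadrant ab w <-> quadrant ab y)}.
Proof.
have null (a : option R) :
    exists2 N : set (measurableTypeR R), measurable N /\ mu N = 0%E &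
    forall r, ~ N r -> a <> Some r.
  case: a => [a|]; last by exists set0; [split => //; exact: measure0|].
  exists [set a]; first by split; [exact: measurable_set1|exact: lebesgue_measure_set1].
  by move=> r nra [ar]; apply: nra.
have [N [mN N0] aN] := null ab.1; have [N' [mN' N'0] bN'] := null ab.2.
exists ((N `*` setT) `|` (setT `*` N')); split.
- by apply: measurableU; apply: measurableX.
- apply/eqP; rewrite -measure_le0.
  apply: le_trans (measureU2 _ _ _) _; [exact: measurableX|exact: measurableX|].
  have EA : l2 (N `*` setT) = 0%E.
    rewrite -[LHS]/((mu \x mu)%E _) product_measure1E//.
    by rewrite -[RHS](mul0e (mu setT)); congr (_ * _)%E; exact: N0.
  have EB : l2 (setT `*` N') = 0%E.
    rewrite -[LHS]/((mu \x mu)%E _) product_measure1E//.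
    by rewrite -[RHS](mule0 (mu setT)); congr (_ * _)%E; exact: N'0.
  by rewrite -[leLHS]/(l2 (N `*` setT) + l2 (setT `*` N'))%E EA EB adde0.
- move=> y /= ny; apply: contrapT => nN; apply: ny.
  have ya : ab.1 <> Some y.1 by apply: aN => ?; apply: nN; left.
  have yb : ab.2 <> Some y.2 by apply: bN' => ?; apply: nN; right.
  have [e1 e10 h1] := ray_locally_constant ya.
  have [e2 e20 h2] := ray_locally_constant yb.
  exists (Num.min e1 e2); first by rewrite lt_min e10.
  move=> w; rewrite lt_min => /andP[we1 we2].
  have hw1 : (y.1 - w.1) ^+ 2 < e1 by apply: le_lt_trans we1; rewrite lerDl sqr_ge0.
  have hw2 : (y.2 - w.2) ^+ 2 < e2 by apply: le_lt_trans we2; rewrite lerDr sqr_ge0.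
  by split => -[? ?]; split; [exact/(h1 _ hw1)|exact/(h2 _ hw2)|
    exact/(h1 _ hw1)|exact/(h2 _ hw2)].
Qed.

(** By self-adjointness, [sigma] paired with the averaged indicator of a quadrant gives 0 for every
    [n]. The averages are at most 1, so [|sigma|] dominates and the limit may be taken under the
    integral. *)
Lemma gtrans_ae_eq0 (sigma : plane R -> R) (u : R^nat) :
  l2.-integrable setT (EFin \o sigma) -> (forall n, n.+1%:R <= u n) ->
  (forall n, {ae l2, forall w, gtrans sigma (u n) w = 0}) ->
  {ae l2, forall x, sigma x = 0}.
Proof.
move=> sI un gu; apply: quadrant_ae_eq0 => // ab.
have mQ := measurable_quadrant ab.
have msigma : measurable_fun setT sigma.
  by apply/measurable_EFinP; exact: measurable_int sI.
have m1 : measurable_fun setT (\1_(quadrant ab) : plane R -> R).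
  exact: measurable_indic.
have un0 n : 0 < u n by apply: lt_le_trans (un n).
have msmear n : measurable_fun setT (smear (u n) (quadrant ab)).
  have m12 : measurable_fun setT (fun z : plane R * plane R => \1_(quadrant ab) z.2 : R).
    exact: (measurableT_comp m1).
  have mF : measurable_fun setT (fun z : plane R * plane R =>
      (expR (- (u n * sqd z.1 z.2)) * \1_(quadrant ab) z.2)%:E).
    by rewrite /sqd; meas.
  apply/measurable_EFinP.
  rewrite (_ : EFin \o _ = fun y => \int[l2]_w
      (expR (- (u n * sqd y w)) * \1_(quadrant ab) w)%:E)%E; last first.
    by apply/funext => y; rewrite -EFin_smear.
  apply: (@measurable_fun_fubini_tonelli_F _ _ _ _ _ l2 _ mF).
  by move=> z; rewrite lee_fin mulr_ge0 ?expR_ge0.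
pose f_ n y := (sigma y * (u n / pi * smear (u n) (quadrant ab) y))%:E.
pose f y := (sigma y * \1_(quadrant ab) y)%:E.
have f_0 n : (\int[l2]_y f_ n y = 0)%E.
  have upi : 0 <= u n / pi by rewrite divr_ge0 ?pi_ge0 ?ltW.
  rewrite (@gtrans_swap _ _ sI (u n) (u n / pi)
    (fun w => u n / pi * \1_(quadrant ab) w)).
  - rewrite -[RHS](integral0 l2 setT); apply: ae_eq_integral.
    + by [].
    + have mg := measurable_gtrans sI (un0 n); by meas.
    + exact: measurable_cst.
    + by apply: ae_mono (gu n) => w -> _; rewrite mul0r.
  - exact: un0.
  - by meas.
  - move=> w; rewrite indicE; case: (_ \in _) => /=.
      by rewrite mulr1 ger0_norm.
    by rewrite mulr0 normr0.
  - move=> y; rewrite EFinM EFin_smear//.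
    apply: ge0_integral_scale.
    + by [].
    + exact: mE.
    + by move=> w; exact: E0.
    + by move=> w; ring.
have mf_ n : measurable_fun setT (f_ n).
  by have mn := msmear n; rewrite /f_; meas.
have mf : measurable_fun setT f by rewrite /f; meas.
have f_f : {ae l2, forall y, setT y -> f_ n y @[n --> \oo] --> f y}.
  apply: ae_mono (quadrant_locally_constant ab) => y [e e0 he] _.
  rewrite /f_ /f; apply: cvg_EFin; first exact: nearW.
  by apply: cvgMr; exact: smear_cvg he.
have f_g : {ae l2, forall y n, setT y -> (`|f_ n y| <= (`|sigma y|)%:E)%E}.
  apply: aeW => y n _; rewrite /f_ abse_EFin lee_fin normrM ler_piMr//.
  have upi : 0 <= u n / pi by rewrite divr_ge0 ?pi_ge0 ?ltW.
  rewrite ger0_norm; last exact: (mulr_ge0 upi (smear_ge0 _ _ _)).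
  apply: le_trans (ler_wpM2l upi (smear_le y mQ (un0 n))) _.
  rewrite le_eqVlt; apply/orP; left; apply/eqP.
  by move: (@pi R) (pi_gt0 R) => p p0; field; rewrite !gt_eqF.
have [_ _ cv] := dominated_convergence measurableT mf_ mf f_f (integrable_norm sI) f_g.
have : (\int[l2]_y f y = 0)%E.
  apply/esym; apply: (cvg_unique _ _ cv) => //.
  rewrite (_ : [sequence _]_n = cst 0%E); first exact: cvg_cst.
  by apply/funext => n; exact: f_0.
move=> <-; rewrite integral_mkcond; apply: eq_integral => y _.
by rewrite patchE /f indicE; case: (_ \in _); rewrite ?mulr1 ?mulr0.
Qed.

End gauss_approximation.

(** * Neutral densities *)

Section neutral_energy.
Context {R : realType}.
Local Notation mu := (@lebesgue_measure R).
Local Notation l2 := (@lebesgue2 R).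
Local Notation l4 := (@lebesgue4 R).
Local Notation hl := (@halfline R).

Lemma measurable_sqd : measurable_fun setT (fun z : plane R * plane R => sqd z.1 z.2).
Proof. by rewrite /sqd; meas. Qed.

Lemma ae_sqd_gt0 : {ae l4, forall z, 0 < sqd z.1 z.2}.
Proof.
exists [set z | sqd z.1 z.2 = 0]; split.
- rewrite -[X in measurable X]setTI.
  exact: (measurable_sqd measurableT (measurable_set1 0)).
(* The product measure is unfolded into the integral of the measures of sections; those of the
   diagonal are points. *)
- rewrite -[LHS]/(\int[l2]_x (l2 \o xsection [set z | sqd z.1 z.2 = 0%R]) x)%E.
  rewrite integral0_eq// => x _ /=.
  rewrite (_ : xsection _ _ = [set x]); first exact: lebesgue2_set1.
  apply/seteqP; split => y; rewrite /xsection/= inE/=.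
    move=> xy; apply: contrapT => /nesym/sqd_gt0.
    by rewrite xy ltxx.
  by move=> ->; rewrite /sqd !subrr expr0n addr0.
- move=> z /= /negP; rewrite -leNgt => z0.
  by apply/eqP; rewrite eq_le z0 sqd_ge0.
Qed.

Variable sigma : plane R -> R.
Hypothesis sI : l2.-integrable setT (EFin \o sigma).
Hypothesis s0 : (\int[l2]_x (sigma x)%:E = 0)%E.
Hypothesis ssI : l4.-integrable setT (EFin \o bilin sigma sigma).

Let msigma : measurable_fun setT sigma.
Proof. by apply/measurable_EFinP; exact: measurable_int sI. Qed.

Let mss : measurable_fun setT (fun z : plane R * plane R => sigma z.1 * sigma z.2).
Proof.
apply: measurable_funM.
  exact: (measurableT_comp msigma).
exact: (measurableT_comp msigma).
Qed.

Let H (t : R) : \bar R :=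
  (\int[l4]_z (sigma z.1 * sigma z.2 * frul (sqd z.1 z.2) t)%:E)%E.

Let mH : measurable_fun setT H.
Proof. exact: (measurable_frullani_fubini mss measurable_sqd ae_sqd_gt0 ssI). Qed.

Let HE t : 0 < t ->
  H t = ((- (4 / pi))%:E * \int[l2]_w (gtrans sigma (2 * t) w ^+ 2)%:E)%E.
Proof. by move=> t0; exact: integral_sigma2_frul. Qed.

Let c4 : 0 < 4 / pi :> R.
Proof. by rewrite divr_gt0 ?pi_gt0. Qed.

Let H_le0 t : 0 < t -> (H t <= 0)%E.
Proof.
move=> t0; rewrite HE// EFinN mulNe oppe_le0 mule_ge0//.
  by rewrite lee_fin ltW.
by apply: integral_ge0 => w _; rewrite lee_fin sqr_ge0.
Qed.

(** [H] has a known sign only for [t > 0]; [|H|] coincides with [- H] there and is nonnegative on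
    the whole line. *)
Let energyE : (\int[l4]_z (bilin sigma sigma z)%:E = - \int[hl]_t `|H t|)%E.
Proof.
rewrite -integral_ge0N; last by move=> t _; exact: abse_ge0.
rewrite -[LHS]/(\int[l4]_z (sigma z.1 * sigma z.2 * ln (sqd z.1 z.2))%:E)%E.
rewrite (frullani_fubini mss measurable_sqd ae_sqd_gt0 ssI).
by apply: eq_halfline => t t0; rewrite lee0_abs ?oppeK ?H_le0.
Qed.

Lemma neutral_energy_le0 : (\int[l4]_z (bilin sigma sigma z)%:E <= 0)%E.
Proof.
rewrite energyE oppe_le0.
by apply: integral_ge0 => t _; exact: abse_ge0.
Qed.

Let gtrans_eq0 t : 0 < t -> H t = 0%E ->
  {ae l2, forall w, gtrans sigma (2 * t) w = 0}.
Proof.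
move=> t0; have t20 : 0 < 2 * t by rewrite mulr_gt0.
have mg := measurable_gtrans sI t20.
rewrite HE// => /eqP; rewrite mule_eq0 eqe oppr_eq0 (gt_eqF c4)/= => /eqP g0.
have : ae_eq l2 setT (fun w => (gtrans sigma (2 * t) w ^+ 2)%:E) (cst 0%E).
  apply/ae_eq_integral_abs => //; first by meas.
  rewrite -g0; apply: eq_integral => w _.
  by rewrite gee0_abs// lee_fin sqr_ge0.
apply: ae_mono => w /(_ I) [] /eqP.
by rewrite sqrf_eq0 => /eqP.
Qed.

Lemma neutral_energy_eq0 : (\int[l4]_z (bilin sigma sigma z)%:E = 0)%E ->
  {ae l2, forall x, sigma x = 0}.
Proof.
rewrite energyE => /eqP; rewrite oppe_eq0 => /eqP iH.
have H0 : ae_eq hl setT H (cst 0%E) by exact/ae_eq_integral_abs.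
(* The [t] with [H t] nonzero are negligible, while []n + 1, +oo[] has infinite measure, so it
   contains a zero of [H]. *)
have ex n : {t : R | n.+1%:R < t & H t = 0%E}.
  apply: cid2; apply: contrapT => nex.
  pose A : set (measurableTypeR R) := `]n.+1%:R, +oo[%classic.
  have mA : measurable A by exact: measurable_itv.
  have AN : hl.-negligible A.
    apply: negligibleS H0 => t; rewrite /A/= in_itv/= andbT => nt Ht.
    by apply: nex; exists t => //; exact: Ht.
  have := measure_negligible mA AN.
  rewrite -[LHS]/(mu (A `&` `]0%R, +oo[%classic)) setIidl.
    by rewrite /A lebesgue_measure_itv/= ltry.
  move=> t; rewrite /A/= !in_itv/= !andbT; apply: lt_trans.
  by rewrite ltr0n.
(* A zero of [H] at [t] makes the transform vanish at parameter [2 t]. *)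
pose u n := 2 * s2val (ex n).
apply: (@gtrans_ae_eq0 _ sigma u) => //.
  move=> n; rewrite /u; case: (ex n) => t /= nt _.
  have : 0 < n.+1%:R :> R by rewrite ltr0n.
  lra.
move=> n; rewrite /u; case: (ex n) => t /= nt Ht; apply: gtrans_eq0 => //.
by apply: lt_trans nt; rewrite ltr0n.
Qed.

Lemma neutral_energy_ae0 : {ae l2, forall x, sigma x = 0} ->
  (\int[l4]_z (bilin sigma sigma z)%:E = 0)%E.
Proof.
move=> z0; rewrite energyE; apply/eqP; rewrite oppe_eq0; apply/eqP.
rewrite -[RHS](integral0 hl setT); apply: eq_halfline => t t0.
rewrite HE// (_ : integral _ _ _ = 0)%E ?mule0 ?abse0//.
rewrite integral0_eq// => w _.
suff -> : gtrans sigma (2 * t) w = 0 by rewrite expr0n.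
rewrite /gtrans /Rintegral (_ : integral _ _ _ = 0)%E//.
rewrite -[RHS](integral0 l2 setT); apply: ae_eq_integral.
- by [].
- by rewrite /sqd; meas.
- exact: measurable_cst.
- by apply: ae_mono z0 => y -> _; rewrite mul0r.
Qed.

End neutral_energy.

(** * The inequality *)

Section energy_identity.
Context {R : realType}.
Local Notation l2 := (@lebesgue2 R).
Local Notation l4 := (@lebesgue4 R).
Local Notation "'p0'" := ((0, 0) : plane R).

Lemma log_moment_densityE (f : plane R -> R) x :
  log_moment_density f x = f x * ln (1 + sqn x).
Proof. by rewrite /log_moment_density enorm_sqr mulrC. Qed.

Lemma log_energy_densityE (f : plane R -> R) z :
  log_energy_density f z = 2^-1 * bilin f f z.
Proof.
rewrite /log_energy_density /bilin mulrCA; congr (_ * _).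
rewrite /enorm -/(sqd z.1 z.2).
(* On the diagonal both logarithms are [ln 0 = 0], so the identity holds at every point. *)
have := sqd_ge0 z.1 z.2; rewrite le_eqVlt => /predU1P[<-|d0].
  by rewrite sqrtr0 ln0// mulr0.
rewrite -[in RHS](sqr_sqrtr (ltW d0)) lnXn ?sqrtr_gt0//.
by field.
Qed.

(** The case [x = 0] of [integral_pstar_ln1D]; it is also the value of [J(p, p)]. *)
Lemma integral_pstar_ln1sqn : (\int[l2]_x (pstar x * ln (1 + sqn x))%:E = 1)%E.
Proof.
rewrite -integral_pstar0_ln1D -integral_pstar_ln1D.
by apply: eq_integral => x _; rewrite sqd0.
Qed.

Lemma integrable_pstar_ln1sqn :
  l2.-integrable setT (fun x => (pstar x * ln (1 + sqn x))%:E).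
Proof.
have mp := @measurable_pstar R.
apply: (@ge0_integrable _ _ _ _ _ 1).
- by rewrite /sqn; meas.
- by move=> x; rewrite mulr_ge0 ?pstar_ge0// ln1D_ge0// sqn_ge0.
- by rewrite integral_pstar_ln1sqn.
Qed.

(** Places the profile among the competitors, so that equality is attained and not merely
    characterized. *)
Lemma admissible_rho_star (M : R) : 0 < M -> admissible M (rho_star M).
Proof.
move=> M0.
have rE : rho_star M = (fun x => M * pstar x) by apply/funext => x; exact: rho_starE.
have pI := @integrable_pstar R; have plI := integrable_pstar_ln1sqn.
rewrite rE; split.
- split; first exact: (integrableZl measurableT M pI).
  by apply: aeW => x; rewrite mulr_ge0 ?pstar_ge0// ltW.
- rewrite /mass /Rintegral -[RHS]/(fine M%:E) -[M%:E]mule1 -integral_pstar; congr fine.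
  by rewrite -integralZl//; apply: eq_integral => x _; rewrite EFinM.
- apply: eq_integrable (integrableZl measurableT M plI) => // x _.
  by rewrite -EFinM /= log_moment_densityE; congr EFin; exact: mulrA.
- apply: eq_integrable (integrableZl measurableT (2^-1 * M ^+ 2)
    (integrable_bilin_pstarr pI plI)) => // z _.
  by rewrite /= log_energy_densityE -EFinM /bilin; congr EFin; ring.
Qed.

Variables (M : R) (rho : plane R -> R).
Hypothesis rhoA : admissible M rho.

Definition deviation x : R := rho x - M * pstar x.

Let rI : l2.-integrable setT (EFin \o rho).
Proof. by case: rhoA => -[]. Qed.

Let lI : l2.-integrable setT (fun x => (rho x * ln (1 + sqn x))%:E).
Proof.
case: rhoA => _ _ + _; apply: eq_integrable => // x _.
by rewrite /= log_moment_densityE.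
Qed.

Let lE : (\int[l2]_x (rho x * ln (1 + sqn x))%:E = (log_moment rho)%:E)%E.
Proof.
rewrite /log_moment /Rintegral fineK; last first.
  by apply: integrable_fin_num => //; case: rhoA.
by apply: eq_integral => x _; rewrite log_moment_densityE.
Qed.

Let eI : l4.-integrable setT (EFin \o bilin rho rho).
Proof.
case: rhoA => _ _ _ h; apply: eq_integrable (integrableZl measurableT 2 h) => // z _.
by rewrite /= log_energy_densityE -EFinM mulrA divff// mul1r.
Qed.

Let eE : (\int[l4]_z (bilin rho rho z)%:E = (2 * log_energy rho)%:E)%E.
Proof.
case: rhoA => _ _ _ h; rewrite EFinM /log_energy /Rintegral fineK; last first.
  exact: integrable_fin_num.
rewrite -integralZl//; apply: eq_integral => z _.
by rewrite log_energy_densityE -EFinM mulrA divff// mul1r.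
Qed.

Lemma integrable_deviation : l2.-integrable setT (EFin \o deviation).
Proof.
have pI := integrableZl measurableT M (@integrable_pstar R).
exact: (integrableB measurableT rI pI).
Qed.

Lemma integral_deviation : (\int[l2]_x (deviation x)%:E = 0)%E.
Proof.
have pI := @integrable_pstar R.
transitivity (\int[l2]_x ((rho x)%:E - M%:E * (pstar x)%:E))%E; first exact: eq_integral.
rewrite integralB//; last exact: integrableZl.
rewrite integralZl// integral_pstar mule1.
have [_ rM _ _] := rhoA.
have -> : (\int[l2]_x (rho x)%:E = M%:E)%E.
  by rewrite -rM /mass /Rintegral fineK//; exact: integrable_fin_num.
by rewrite subee.
Qed.

Let bE z : (bilin deviation deviation z)%:E =
  ((bilin rho rho z)%:E - (M%:E * (bilin rho pstar z)%:E +
    M%:E * (bilin pstar rho z)%:E) + (M ^+ 2)%:E * (bilin pstar pstar z)%:E)%E.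
Proof. by rewrite -!EFinM -!EFinD; congr EFin; rewrite /bilin /deviation; ring. Qed.

Let crossrI := integrable_bilin_pstarr rI lI.
Let crosslI := integrable_bilin_pstarl rI lI.
Let ppI := integrable_bilin_pstarr (@integrable_pstar R) integrable_pstar_ln1sqn.

Let crossI : l4.-integrable setT (fun z => M%:E * (bilin rho pstar z)%:E +
  M%:E * (bilin pstar rho z)%:E)%E.
Proof. by apply: integrableD => //; exact: integrableZl. Qed.

Lemma integrable_bilin_deviation :
  l4.-integrable setT (EFin \o bilin deviation deviation).
Proof.
have h1 := integrableB measurableT eI crossI.
have h2 := integrableD measurableT h1 (integrableZl measurableT (M ^+ 2) ppI).
by apply: eq_integrable h2 => // z _; rewrite /= bE.
Qed.

Lemma integral_bilin_deviation :
  (\int[l4]_z (bilin deviation deviation z)%:E =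
   (2 * log_energy rho - 2 * M * log_moment rho + M ^+ 2)%:E)%E.
Proof.
have h1 := integrableB measurableT eI crossI.
under eq_integral do rewrite bE.
rewrite integralD//; last exact: integrableZl.
rewrite integralB// integralD//; [|exact: integrableZl..].
rewrite !integralZl// eE integral_bilin_pstarr// integral_bilin_pstarl//.
rewrite integral_bilin_pstarr//;
  [|exact: integrable_pstar|exact: integrable_pstar_ln1sqn].
rewrite integral_pstar_ln1sqn lE -!EFinM -!EFinD; congr EFin; ring.
Qed.

End energy_identity.

Unset Implicit Arguments.

Theorem lemma1 (R : realType) (M : R) (M_gt0 : 0 < M) :
  (forall rho : plane R -> R, admissible M rho ->
     2 / M * log_energy rho <= 2 * log_moment rho - M /\
     (2 * log_moment rho - M = 2 / M * log_energy rho <->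
      {ae @lebesgue2 R, forall x, rho x = rho_star M x})) /\
  admissible M (rho_star M).
Proof.
split; last exact: admissible_rho_star.
move=> rho rhoA.
have dI := integrable_deviation rhoA; have d0 := integral_deviation rhoA.
have ddI := integrable_bilin_deviation rhoA.
have ddE := integral_bilin_deviation rhoA.
set J := _ - _ + _ in ddE.
have JE : 2 * log_moment rho - M - 2 / M * log_energy rho = - (J / M).
  by rewrite /J; field; rewrite gt_eqF.
split.
- rewrite -subr_ge0 JE oppr_ge0 pmulr_lle0 ?invr_gt0// -lee_fin -ddE.
  exact: neutral_energy_le0.
- split=> [/eqP|ae].
  + rewrite -subr_eq0 JE oppr_eq0 mulf_eq0 invr_eq0 (gt_eqF M_gt0) orbF => /eqP J0.
    have : {ae @lebesgue2 R, forall x, deviation M rho x = 0}.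
      by apply: neutral_energy_eq0 => //; rewrite ddE J0.
    by apply: ae_mono => x /eqP; rewrite subr_eq0 rho_starE => /eqP.
  + have dev0 : {ae @lebesgue2 R, forall x, deviation M rho x = 0}.
      by apply: ae_mono ae => x; rewrite /deviation rho_starE => ->; rewrite subrr.
    have := neutral_energy_ae0 dI d0 ddI dev0; rewrite ddE => -[J0].
    by apply/eqP; rewrite -subr_eq0 JE J0 mul0r oppr0.
Qed.
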